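(* The weakly anti-monotone $C^*$-algebra $\mathcal{W}^a_{\mathbb{N}}$ is not a type-I $C^*$-algebra.
   Context: Here $\mathbb{N}=\{1,2,\ldots\}$ and $\{e_i:i\in\mathbb{N}\}$ is the canonical orthonormal basis of $\ell^2(\mathbb{N})$. The weakly anti-monotone Fock space $\mathcal{F}_{wam}(\ell^2(\mathbb{N}))$ is the closed subspace of the full Fock space over $\ell^2(\mathbb{N})$ with orthonormal basis the vacuum vector $\Omega$ and all $e_{i_1}\otimes\cdots\otimes e_{i_k}$ with $k\geq 1$ and $1\leq i_1\leq i_2\leq\cdots\leq i_k$. For $i\geq 1$ the creator $A_i^\dagger$ is the bounded operator with $A_i^\dagger\Omega=e_i$ and $A_i^\dagger\, e_{i_1}\otimes\cdots\otimes e_{i_k}=e_i\otimes e_{i_1}\otimes\cdots\otimes e_{i_k}$ if $i\leq i_1$, and $=0$ otherwise; $A_i$ is its adjoint. $\mathcal{W}^a_{\mathbb{N}}\subset\mathcal{B}(\mathcal{F}_{wam}(\ell^2(\mathbb{N})))$ is the $C^*$-algebra generated by $\{A_i,A_i^\dagger:i\geq 1\}$. *)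

(* Defs.v *)
From HB Require Import structures.
From mathcomp Require Import all_boot all_order all_algebra.
From mathcomp Require Import complex ring lra.
From mathcomp Require Import boolp classical_sets functions cardinality fsbigop.
From mathcomp Require Import reals ereal topology normedtype numfun esum.

Set Implicit Arguments.
Unset Strict Implicit.
Unset Printing Implicit Defensive.

Import Order.TTheory GRing.Theory Num.Theory.
Import numFieldNormedType.Exports.

Local Open Scope classical_set_scope.
Local Open Scope ring_scope.

Section CauchySchwarz.
Variables (C : numClosedFieldType) (V : lmodType C) (f : {dot V for (@Num.conj C)}).

Let nrm (x : V) : C := sqrtC (f x x).

Lemma dot_CauchySchwarz x y : `|f x y| ^+ 2 <= f x x * f y y.
Proof.
have [->|y0] := eqVneq y 0; first by rewrite !linear0r normr0 expr0n mulr0.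
have yy : 0 < f y y by rewrite dnorm_gt0.
pose c := f x y / f y y.
have := dnorm_ge0 f (x - c *: y).
rewrite dnormB dnormZ linearZr_LR /=.
have E2 : (f y y)^* = f y y by apply/CrealP/ger0_real/ltW.
have cE : c^* = (f x y)^* / f y y.
  by rewrite /c rmorphM fmorphV /= E2.
have -> : c^* * f x y = `|f x y| ^+ 2 / f y y by rewrite cE normCK mulrAC [_^* * _]mulrC.
have -> : `|c| ^+ 2 * f y y = `|f x y| ^+ 2 / f y y.
  rewrite /c normrM normfV (ger0_norm (ltW yy)) exprMn -mulrA; congr (_ * _).
  by rewrite expr2 -mulrA mulVf ?gt_eqF// mulr1.
have -> : (`|f x y| ^+ 2 / f y y)^* = `|f x y| ^+ 2 / f y y.
  by apply/CrealP/ger0_real; rewrite divr_ge0// ?exprn_ge0// ltW.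
by rewrite opprD addrA addrK subr_ge0 ler_pdivrMr.
Qed.

Lemma dot_normD x y : nrm (x + y) <= nrm x + nrm y.
Proof.
have n0 z : 0 <= nrm z by rewrite sqrtC_ge0.
have nK z : nrm z ^+ 2 = f z z by rewrite sqrtCK.
rewrite -(@ler_pXn2r _ 2%N)// ?nnegrE ?addr_ge0// nK dnormD sqrrD !nK addrAC lerD2r.
rewrite lerD2l.
have -> : f x y + (f x y)^* = 'Re (f x y) *+ 2.
  by rewrite ReE -mulr_natr divfK ?pnatr_eq0.
rewrite lerMn2r/=; apply: le_trans (_ : `|f x y| <= _).
  by rewrite leif_Re_Creal.
by rewrite -(@ler_pXn2r _ 2%N)// ?nnegrE ?mulr_ge0// exprMn !nK dot_CauchySchwarz.
Qed.

Lemma dot_normZ (l : C) x : nrm (l *: x) = `|l| * nrm x.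
Proof.
by rewrite /nrm dnormZ rootCMl ?exprn_ge0//; congr (_ * _); rewrite sqrCK.
Qed.

Lemma dot_norm_eq0 x : nrm x = 0 -> x = 0.
Proof. by move/eqP; rewrite sqrt_dnorm_eq0 => /eqP. Qed.

End CauchySchwarz.

HB.mixin Record NormedModule_hasInner (R : realType) (V : Type)
    & NormedModule R[i] V := {
  inner : {dot V for (@Num.conj R[i])};
  sqr_normE : forall x : V, `|x| ^+ 2 = inner x x
}.

#[short(type="preHilbertType")]
HB.structure Definition PreHilbert (R : realType) :=
  {V of NormedModule R[i] V & NormedModule_hasInner R V}.

#[short(type="hilbertType")]
HB.structure Definition Hilbert (R : realType) :=
  {V of PreHilbert R V & Complete V}.

Arguments inner {R s}.

(* An inner product on a module induces the norm, hence the topology. *)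
HB.factory Record Lmodule_hasInner (R : realType) V
    & GRing.Lmodule R[i] V := {
  inner_form : {dot V for (@Num.conj R[i])}
}.

HB.builders Context R V & Lmodule_hasInner R V.

HB.instance Definition _ := Lmodule_isNormed.Build R[i] V
  (@dot_normD _ _ inner_form) (@dot_normZ _ _ inner_form)
  (@dot_norm_eq0 _ _ inner_form).

Let sqr_normE (x : V) : `|x| ^+ 2 = inner_form x x.
Proof. exact: sqrtCK. Qed.

HB.instance Definition _ := NormedModule_hasInner.Build R V sqr_normE.

HB.end.

Local Open Scope complex_scope.

Section Sums.
Variables (R : realType) (I : choiceType).
Implicit Types (a b : I -> R) (z w : I -> R[i]).

(* Unconditional sums over an arbitrary index type; they are only meaningful
   for summable families. *)
Definition rsummable a : bool := summable [set: I] (EFin \o a).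

Definition rsum a : R :=
  fine (\esum_(i in [set: I]) (EFin \o a)^\+ i -
        \esum_(i in [set: I]) (EFin \o a)^\- i)%E.

Definition csummable z : bool :=
  rsummable (fun i => complex.Re (z i)) && rsummable (fun i => complex.Im (z i)).

Definition csum z : R[i] :=
  rsum (fun i => complex.Re (z i)) +i* rsum (fun i => complex.Im (z i)).

Lemma le_rsummable a b : (forall i, `|a i| <= `|b i|) -> rsummable b -> rsummable a.
Proof.
move=> ab; apply: le_lt_trans; apply: le_esum => i _ /=.
by rewrite lee_fin.
Qed.

Lemma rsummableD a b : rsummable a -> rsummable b -> rsummable (fun i => a i + b i).
Proof. by move=> sa sb; have := summableD sa sb. Qed.

Lemma rsummableN a : rsummable a -> rsummable (fun i => - a i).
Proof. by apply: le_rsummable => i; rewrite normrN. Qed.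

Lemma esumZ (k : R) (a : I -> \bar R) : 0 <= k -> (forall i, 0 <= a i)%E ->
  (\esum_(i in [set: I]) (k%:E * a i) = k%:E * \esum_(i in [set: I]) a i)%E.
Proof.
rewrite le_eqVlt => /predU1P[<- _|k0 a0].
  by rewrite mul0e; apply: esum1 => i _; rewrite mul0e.
have le c (b : I -> \bar R) : 0 < c -> (forall i, 0 <= b i)%E ->
    (\esum_(i in [set: I]) (c%:E * b i) <= c%:E * \esum_(i in [set: I]) b i)%E.
  move=> c0 b0; apply: ge_ereal_sup => _ [X XI <-].
  rewrite -ge0_mule_fsumr//; apply: lee_wpmul2l; first by rewrite lee_fin ltW.
  by apply: ereal_sup_ubound; exists X.
apply/eqP; rewrite eq_le le//=.
have : (\esum_(i in [set: I]) a i <= k^-1%:E * \esum_(i in [set: I]) (k%:E * a i))%E.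
  apply: le_trans (le _ _ _ _); rewrite ?invr_gt0//.
    by apply: le_esum => i _; rewrite muleA -EFinM mulVf ?gt_eqF// mul1e.
  by move=> i; rewrite mule_ge0// lee_fin ltW.
move/(lee_wpmul2l (_ : (0 <= k%:E)%E)); rewrite lee_fin ltW// => /(_ isT).
by rewrite muleA -EFinM mulfV ?gt_eqF// mul1e.
Qed.

Lemma rsum_ge0E a : (forall i, 0 <= a i) ->
  rsum a = fine (\esum_(i in [set: I]) (a i)%:E).
Proof.
move=> a0; rewrite /rsum [X in (_ - X)%E]esum1 ?sube0; last first.
  by move=> i _; rewrite funenegE /=; apply/max_idPr; rewrite lee_fin oppr_le0.
congr fine; apply: eq_esum => i _.
by rewrite funeposE /=; apply/max_idPl; rewrite lee_fin.
Qed.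

Lemma rsummable_ge0E a : (forall i, 0 <= a i) ->
  rsummable a = (\esum_(i in [set: I]) (a i)%:E < +oo)%E.
Proof.
move=> a0; rewrite /rsummable /summable; congr (_ < _)%E.
by apply: eq_esum => i _; rewrite /= ger0_norm.
Qed.

Lemma rsumB a b : rsummable a -> rsummable b ->
  (forall i, 0 <= a i) -> (forall i, 0 <= b i) ->
  rsum (fun i => a i - b i) = rsum a - rsum b.
Proof.
move=> sa sb a0 b0; rewrite [rsum a]rsum_ge0E// [rsum b]rsum_ge0E//.
have := @esumB _ _ setT (EFin \o a) (EFin \o b) sa sb
  (fun i _ => a0 i) (fun i _ => b0 i).
rewrite /rsum => ->; rewrite fineB//.
- rewrite ge0_fin_numE ?esum_ge0// => [|i _]; last by rewrite lee_fin.
  by rewrite -rsummable_ge0E.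
- rewrite ge0_fin_numE ?esum_ge0// => [|i _]; last by rewrite lee_fin.
  by rewrite -rsummable_ge0E.
Qed.

Lemma rsumD_ge0 a b : rsummable a -> rsummable b ->
  (forall i, 0 <= a i) -> (forall i, 0 <= b i) ->
  rsum (fun i => a i + b i) = rsum a + rsum b.
Proof.
move=> sa sb a0 b0; rewrite !rsum_ge0E//; last by move=> i; rewrite addr_ge0.
under eq_esum do rewrite EFinD.
rewrite esumD; [|by move=> i _; rewrite lee_fin..].
rewrite fineD//.
- rewrite ge0_fin_numE ?esum_ge0// => [|i _]; last by rewrite lee_fin.
  by rewrite -rsummable_ge0E.
- rewrite ge0_fin_numE ?esum_ge0// => [|i _]; last by rewrite lee_fin.
  by rewrite -rsummable_ge0E.
Qed.

Let pp (x : R) := Num.max x 0.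
Let pn (x : R) := Num.max (- x) 0.
Let pp0 x : 0 <= pp x. Proof. by rewrite le_max lexx orbT. Qed.
Let pn0 x : 0 <= pn x. Proof. by rewrite le_max lexx orbT. Qed.
Let ppn x : x = pp x - pn x.
Proof.
rewrite /pp /pn; have [x0|x0] := leP x 0.
  by rewrite max_l ?oppr_ge0// opprK add0r.
by rewrite max_r ?subr0// oppr_le0 ltW.
Qed.
Let sp a : rsummable a -> rsummable (pp \o a).
Proof.
apply: le_rsummable => i /=; rewrite ger0_norm// ge_max normr_ge0 andbT.
exact: ler_norm.
Qed.
Let sn a : rsummable a -> rsummable (pn \o a).
Proof.
apply: le_rsummable => i /=; rewrite ger0_norm// ge_max normr_ge0 andbT.
by rewrite -normrN; exact: ler_norm.
Qed.
Let rsum_pn a : rsummable a -> rsum a = rsum (pp \o a) - rsum (pn \o a).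
Proof.
move=> sa; rewrite -rsumB//; [|exact: sp|exact: sn|by move=> i /=..].
by congr rsum; apply/funext => i /=.
Qed.

Lemma rsumD a b : rsummable a -> rsummable b ->
  rsum (fun i => a i + b i) = rsum a + rsum b.
Proof.
move=> sa sb; rewrite (rsum_pn sa) (rsum_pn sb) addrACA -opprD.
rewrite -(rsumD_ge0 (sp sa) (sp sb))//; [|by move=> i /=..].
rewrite -(rsumD_ge0 (sn sa) (sn sb))//; [|by move=> i /=..].
rewrite -rsumB; first last.
- by move=> i /=; rewrite addr_ge0.
- by move=> i /=; rewrite addr_ge0.
- exact: rsummableD (sn sa) (sn sb).
- exact: rsummableD (sp sa) (sp sb).
by congr rsum; apply/funext => i /=; rewrite opprD addrACA -!ppn.
Qed.

Lemma rsum0 : rsum (fun=> 0) = 0.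
Proof. by rewrite rsum_ge0E// esum1. Qed.

Lemma rsummable0 : rsummable (fun=> 0).
Proof. by rewrite rsummable_ge0E// esum1// ltry. Qed.

Lemma rsumN a : rsummable a -> rsum (fun i => - a i) = - rsum a.
Proof.
move=> sa; apply/eqP; rewrite -addr_eq0 addrC -rsumD ?rsummableN//.
by under [X in rsum X]eq_fun do rewrite subrr; rewrite rsum0.
Qed.

Lemma rsum_ge0 a : (forall i, 0 <= a i) -> 0 <= rsum a.
Proof.
by move=> a0; rewrite rsum_ge0E// fine_ge0// esum_ge0// => i _; rewrite lee_fin.
Qed.

Let rsumZ_ge0 k a : 0 <= k -> (forall i, 0 <= a i) ->
  rsummable a -> rsum (fun i => k * a i) = k * rsum a.
Proof.
move=> k0 a0 sa; rewrite !rsum_ge0E//; last by move=> i; rewrite mulr_ge0.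
under eq_esum do rewrite EFinM.
rewrite esumZ// fineM// ge0_fin_numE ?esum_ge0// => [|i _]; last by rewrite lee_fin.
by rewrite -rsummable_ge0E.
Qed.

Lemma rsummableZ k a : rsummable a -> rsummable (fun i => k * a i).
Proof.
move=> sa; rewrite /rsummable /summable.
under eq_esum do rewrite /= normrM EFinM.
rewrite esumZ//; apply: lte_mul_pinfty => //; exact: sa.
Qed.

Lemma rsumZ k a : rsummable a -> rsum (fun i => k * a i) = k * rsum a.
Proof.
suff H c : 0 <= c -> rsummable a -> rsum (fun i => c * a i) = c * rsum a.
  move=> sa; have [k0|k0] := leP 0 k; first exact: H.
  rewrite -[k in RHS]opprK mulNr -H// ?oppr_ge0 ?ltW//.
  rewrite -rsumN; last exact: rsummableZ.
  by congr rsum; apply/funext => i; rewrite mulNr opprK.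
move=> c0 sa; rewrite (rsum_pn sa) mulrBr.
rewrite -(rsumZ_ge0 c0 _ (sp sa))//; last by move=> i /=.
rewrite -(rsumZ_ge0 c0 _ (sn sa))//; last by move=> i /=.
rewrite -rsumB; first last.
- by move=> i /=; rewrite mulr_ge0.
- by move=> i /=; rewrite mulr_ge0.
- exact: rsummableZ (sn sa).
- exact: rsummableZ (sp sa).
by congr rsum; apply/funext => i /=; rewrite -mulrBr -ppn.
Qed.

Lemma csummableD z w : csummable z -> csummable w ->
  csummable (fun i => z i + w i).
Proof.
move=> /andP[zr zi] /andP[wr wi]; apply/andP; split.
  by under eq_fun do rewrite raddfD /=; exact: rsummableD.
by under eq_fun do rewrite raddfD /=; exact: rsummableD.
Qed.

Lemma csumD z w : csummable z -> csummable w ->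
  csum (fun i => z i + w i) = csum z + csum w.
Proof.
move=> /andP[zr zi] /andP[wr wi]; rewrite /csum.
under eq_fun do rewrite raddfD /=.
under [X in _ +i* rsum X]eq_fun do rewrite raddfD /=.
by rewrite !rsumD.
Qed.

Lemma csumZ (k : R[i]) z : csummable z -> csum (fun i => k * z i) = k * csum z.
Proof.
case: k => kr ki /andP[zr zi]; rewrite /csum.
rewrite [RHS]/GRing.mul /=; congr (_ +i* _).
  rewrite -!rsumZ// -rsumN ?rsummableZ// -rsumD ?rsummableN ?rsummableZ//.
  by congr rsum; apply/funext => i; case: (z i).
rewrite -!rsumZ// -rsumD ?rsummableZ//.
by congr rsum; apply/funext => i; case: (z i).
Qed.

Lemma csum_conj z : csummable z -> csum (fun i => (z i)^*%C) = (csum z)^*%C.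
Proof.
move=> /andP[zr zi]; rewrite /csum /= -rsumN//; congr (_ +i* _).
  by congr rsum; apply/funext => i; case: (z i).
by congr rsum; apply/funext => i; case: (z i).
Qed.

End Sums.

Section FiniteSums.
Variables (R : realType) (I : choiceType).
Implicit Types (a : I -> R).

Lemma rsum_le_bound a M : (forall i, 0 <= a i) ->
  (forall s : seq I, uniq s -> \sum_(i <- s) a i <= M) ->
  rsummable a /\ rsum a <= M.
Proof.
move=> a0 aM.
have le : (\esum_(i in [set: I]) (a i)%:E <= M%:E)%E.
  apply: ge_ereal_sup => _ [X [finX _] <-].
  by rewrite fsbig_finite//= sumEFin lee_fin aM.
have sa : rsummable a by rewrite rsummable_ge0E// (le_lt_trans le)// ltry.
split=> //; rewrite rsum_ge0E// -lee_fin fineK//.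
rewrite ge0_fin_numE ?esum_ge0// => [|i _]; last by rewrite lee_fin.
by rewrite -rsummable_ge0E.
Qed.

Lemma rsum_ge_fin a (s : seq I) : (forall i, 0 <= a i) -> rsummable a ->
  uniq s -> \sum_(i <- s) a i <= rsum a.
Proof.
move=> a0 sa us; rewrite rsum_ge0E// -lee_fin fineK; last first.
  rewrite ge0_fin_numE ?esum_ge0// => [|i _]; last by rewrite lee_fin.
  by rewrite -rsummable_ge0E.
apply: esum_ge; exists [set` s] => //.
by rewrite -sumEFin fsbig_seq.
Qed.

End FiniteSums.

Definition csqr (R : rcfType) (z : R[i]) : R := complex.Re z ^+ 2 + complex.Im z ^+ 2.

Definition square_summable (R : realType) (I : choiceType) : pred (I -> R[i]) :=
  fun f => rsummable (fun i => csqr (f i)).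
Arguments square_summable {R I}.

Record l2 (R : realType) (I : choiceType) := L2 {
  l2_fun :> I -> R[i];
  l2P : l2_fun \in square_summable }.

Section Ell2.
Variables (R : realType) (I : choiceType).
Local Notation C := R[i].

Lemma csqrE (z : C) : (csqr z)%:C = `|z| ^+ 2.
Proof. exact: add_Re2_Im2. Qed.

Lemma csqr_ge0 (z : C) : 0 <= csqr z.
Proof. by rewrite addr_ge0 ?sqr_ge0. Qed.

Lemma csqrM (z w : C) : csqr (z * w) = csqr z * csqr w.
Proof.
by apply: complexI; rewrite csqrE rmorphM /= !csqrE normrM exprMn.
Qed.

Lemma csqrD_le (z w : C) : csqr (z + w) <= 2 * csqr z + 2 * csqr w.
Proof.
rewrite /csqr !raddfD /=; set a := complex.Re z; set b := complex.Re w.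
set c := complex.Im z; set d := complex.Im w.
have E : 2 * (a ^+ 2 + c ^+ 2) + 2 * (b ^+ 2 + d ^+ 2) =
  ((a + b) ^+ 2 + (c + d) ^+ 2) + ((a - b) ^+ 2 + (c - d) ^+ 2) by ring.
by rewrite E lerDl addr_ge0 ?sqr_ge0.
Qed.

HB.instance Definition _ := [isSub for @l2_fun R I].
HB.instance Definition _ := [Choice of l2 R I by <:].

Lemma square_summable_submod : submod_closed (@square_summable R I).
Proof.
split.
  rewrite unfold_in /square_summable; under eq_fun do rewrite /csqr /= !expr0n /= addr0.
  exact: rsummable0.
move=> k f g; rewrite !unfold_in /square_summable => sf sg.
apply: le_rsummable (rsummableD (rsummableZ (2 * csqr k) sf) (rsummableZ 2 sg)) => i.
rewrite !ger0_norm ?csqr_ge0//; last by rewrite addr_ge0// !mulr_ge0// csqr_ge0.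
by rewrite -mulrA -csqrM; exact: csqrD_le.
Qed.

HB.instance Definition _ := GRing.isSubmodClosed.Build C (I -> C) square_summable
  square_summable_submod.
HB.instance Definition _ := [SubChoice_isSubLmodule of l2 R I by <:].

Lemma l2_summable (f : l2 R I) : rsummable (fun i => csqr (f i)).
Proof. exact: l2P. Qed.

Lemma l2P_eq (f g : l2 R I) : f =1 g -> f = g.
Proof. by move=> fg; exact/val_inj/funext. Qed.

Lemma l2DE (f g : l2 R I) i : (f + g) i = f i + g i. Proof. by []. Qed.
Lemma l2NE (f : l2 R I) i : (- f) i = - f i. Proof. by []. Qed.
Lemma l2ZE k (f : l2 R I) i : (k *: f) i = k * f i. Proof. by []. Qed.

Lemma csummable_inner (f g : l2 R I) : csummable (fun i => f i * (g i)^*%C).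
Proof.
have H := rsummableD (l2_summable f) (l2_summable g).
have bnd (a b c d : R) : `|a * b + c * d| <= (a ^+ 2 + c ^+ 2) + (b ^+ 2 + d ^+ 2).
  have := sqr_ge0 (a - b); have := sqr_ge0 (a + b); have := sqr_ge0 (c - d).
  have := sqr_ge0 (c + d) => *; rewrite ler_norml; apply/andP; split; nra.
have nE i : `|csqr (f i) + csqr (g i)| = csqr (f i) + csqr (g i).
  by rewrite ger0_norm// addr_ge0// csqr_ge0.
apply/andP; split; apply: le_rsummable H => i; rewrite nE /csqr.
  case: (f i) (g i) => [a c] [b d] /=; rewrite mulrN opprK; exact: bnd.
case: (f i) (g i) => [a c] [b d] /=.
have := bnd a (- d) c b; rewrite sqrrN [d ^+ 2 + _]addrC; exact.
Qed.

Definition l2_inner (f g : l2 R I) : C := csum (fun i => f i * (g i)^*%C).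

Lemma l2_innerPl g : GRing.linear_for *%R (l2_inner^~ g).
Proof.
move=> k f h; rewrite /l2_inner.
rewrite -csumZ ?csummable_inner// -csumD ?csummable_inner//; last first.
  under eq_fun do rewrite mulrA -l2ZE; exact: csummable_inner.
by congr csum; apply/funext => i; rewrite l2DE l2ZE mulrDl mulrA.
Qed.

Lemma l2_inner_conj f g : l2_inner f g = (l2_inner g f)^*%C.
Proof.
rewrite /l2_inner -csum_conj ?csummable_inner//.
by congr csum; apply/funext => i; rewrite rmorphM /= conjcK mulrC.
Qed.

Lemma l2_innerPr f : GRing.linear_for (Num.conj \; *%R) (l2_inner f).
Proof.
move=> k g h; rewrite l2_inner_conj l2_innerPl rmorphD rmorphM /=.
by rewrite [l2_inner f g]l2_inner_conj [l2_inner f h]l2_inner_conj.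
Qed.

Lemma l2_inner_diag f : l2_inner f f = (rsum (fun i => csqr (f i)))%:C.
Proof.
rewrite /l2_inner /csum; congr (_ +i* _).
  congr rsum; apply/funext => i; rewrite /csqr; case: (f i) => a b /=.
  by rewrite mulrN opprK -!expr2.
rewrite -[RHS](rsum0 R I); congr rsum; apply/funext => i.
by case: (f i) => a b /=; rewrite mulrN mulrC addNr.
Qed.

Lemma l2_inner_pos f : f != 0 -> 0 < l2_inner f f.
Proof.
move=> f0; rewrite l2_inner_diag ltcR lt_neqAle rsum_ge0 ?andbT; last first.
  by move=> i; exact: csqr_ge0.
apply: contra f0 => /eqP s0; apply/eqP/l2P_eq => i.
have := @rsum_ge_fin _ _ _ [:: i] (fun i => csqr_ge0 (f i)) (l2_summable f) isT.
rewrite -s0 big_seq1 => le0.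
have : `|f i| ^+ 2 = 0.
  by rewrite -csqrE; congr (_%:C); apply/eqP; rewrite eq_le le0 csqr_ge0.
by move/eqP; rewrite expf_eq0 /= normr_eq0 => /eqP.
Qed.

HB.instance Definition _ := bilinear_isBilinear.Build C (l2 R I) (l2 R I) C
  *%R (Num.conj \; *%R) l2_inner (l2_innerPl, l2_innerPr).

Lemma l2_inner_herm f g : l2_inner f g = (-1) ^+ false * Num.conj (l2_inner g f).
Proof. by rewrite expr0 mul1r l2_inner_conj. Qed.

HB.instance Definition _ := isHermitianSesquilinear.Build C (l2 R I) false
  (@Num.conj C) l2_inner l2_inner_herm.
HB.instance Definition _ := isDotProduct.Build C (l2 R I) l2_inner l2_inner_pos.

HB.instance Definition _ := Lmodule_hasInner.Build R (l2 R I)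
  (l2_inner : {dot l2 R I for (@Num.conj C)}).

End Ell2.

Section Ell2Complete.
Variables (R : realType) (I : choiceType).
Local Notation C := R[i].

Lemma l2_sqr_norm (f : l2 R I) : `|f| ^+ 2 = (rsum (fun i => csqr (f i)))%:C.
Proof. by rewrite sqr_normE -l2_inner_diag. Qed.

Lemma l2_norm_le (f : l2 R I) (e : R) : 0 <= e ->
  (`|f| <= e%:C) = (rsum (fun i => csqr (f i)) <= e ^+ 2).
Proof.
move=> e0; rewrite -(@ler_pXn2r _ 2%N)// ?nnegrE ?ler0c//.
by rewrite l2_sqr_norm -rmorphXn /= lecR.
Qed.

Lemma l2_fin_le (f : l2 R I) (e : R) (s : seq I) : 0 <= e -> `|f| <= e%:C ->
  uniq s -> \sum_(i <- s) csqr (f i) <= e ^+ 2.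
Proof.
move=> e0; rewrite l2_norm_le// => + us; apply: le_trans.
by apply: rsum_ge_fin us => [i|]; [exact: csqr_ge0|exact: l2_summable].
Qed.

Lemma l2_of_bound (f : I -> C) (e : R) : 0 <= e ->
  (forall s : seq I, uniq s -> \sum_(i <- s) csqr (f i) <= e ^+ 2) ->
  exists2 g : l2 R I, (g : I -> C) = f & `|g| <= e%:C.
Proof.
move=> e0 H; have [sf lef] := rsum_le_bound (fun i => csqr_ge0 (f i)) H.
by exists (L2 (sf : f \in square_summable)) => //; rewrite l2_norm_le.
Qed.

Lemma l2_complete (F : set_system (l2 R I)) : ProperFilter F -> cauchy F -> cvg F.
Proof.
move=> FF /cauchyP cF.
have near_ball (e : R) : 0 < e -> exists x, F [set y | `|x - y| <= e%:C].
  move=> e0; have [|x Fx] := cF e%:C; first by rewrite ltcR.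
  by exists x; apply: filterS Fx => y; rewrite -ball_normE /= => /ltW.
have crd (x y : l2 R I) (e : R) i : 0 <= e -> `|x - y| <= e%:C ->
    csqr (x i - y i) <= e ^+ 2.
  move=> e0 /l2_fin_le => /(_ [:: i] e0 isT); rewrite big_seq1.
  by [].
have crd_cvg (p : C -> R) : (forall z w, p (z - w) = p z - p w) ->
    (forall z, p z ^+ 2 <= csqr z) -> forall i, cvg ((fun y : l2 R I => p (y i)) @ F).
  move=> pB pq i; apply: R_complete; apply: cauchy_exP => e e0.
  have [|x Fx] := near_ball (e / 2); first by rewrite divr_gt0.
  exists (p (x i)); rewrite -ball_normE /= /fmap /=.
  suff : F [set y : l2 R I | `|p (x i) - p (y i)| < e] by [].
  apply: filterS Fx => y /= xy; rewrite -pB.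
  apply: (@le_lt_trans _ _ (e / 2)); last by rewrite ltr_pdivrMr// ltr_pMr// ltr1n.
  rewrite -(@ler_pXn2r _ 2%N)// ?nnegrE ?divr_ge0// ?(ltW e0)//.
  rewrite real_normK ?num_real//; apply: le_trans (pq _) _.
  by apply: crd => //; rewrite divr_ge0// ltW.
have cr i := crd_cvg (@complex.Re R) (fun z w => raddfB _ z w)
  (fun z => ler_wpDr (sqr_ge0 _) (lexx _)) i.
have ci i := crd_cvg (@complex.Im R) (fun z w => raddfB _ z w)
  (fun z => ler_wpDl (sqr_ge0 _) (lexx _)) i.
pose l i : C := lim ((fun y : l2 R I => complex.Re (y i)) @ F) +i*
                lim ((fun y : l2 R I => complex.Im (y i)) @ F).
have cvl (x : l2 R I) i : (fun y : l2 R I => csqr (x i - y i)) @ F --> csqr (x i - l i).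
  rewrite /csqr; under eq_cvg do rewrite !raddfB /= !expr2.
  rewrite !raddfB /= !expr2.
  have hr : (fun y : l2 R I => complex.Re (x i) - complex.Re (y i)) @ F -->
      complex.Re (x i) - lim ((fun y : l2 R I => complex.Re (y i)) @ F).
    by apply: cvgB; [exact: cvg_cst|exact: cr].
  have hi : (fun y : l2 R I => complex.Im (x i) - complex.Im (y i)) @ F -->
      complex.Im (x i) - lim ((fun y : l2 R I => complex.Im (y i)) @ F).
    by apply: cvgB; [exact: cvg_cst|exact: ci].
  by apply: cvgD; apply: cvgM.
have cvs (x : l2 R I) (s : seq I) :
    (fun y : l2 R I => \sum_(i <- s) csqr (x i - y i)) @ F --> \sum_(i <- s) csqr (x i - l i).
  elim: s => [|i s IH].
    rewrite big_nil; under eq_cvg do rewrite big_nil; exact: cvg_cst.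
  rewrite big_cons; under eq_cvg do rewrite big_cons.
  exact: cvgD.
have key (e : R) : 0 < e -> exists x g : l2 R I,
    [/\ F [set y | `|x - y| <= e%:C], (g : I -> C) = (fun i => x i - l i) &
      `|g| <= e%:C].
  move=> e0; have [x Fx] := near_ball e e0; exists x.
  have [|s us|g gE ge] := @l2_of_bound (fun i => x i - l i) e; first exact: ltW.
    apply: (cvgr_to_le (cvs x s)); apply: (filterS _ Fx) => y xy.
    by have := @l2_fin_le (x - y) e s (ltW e0) xy us.
  by exists g.
have [x0 [g0 [_ g0E _]]] := key 1 ltr01.
have [L LE] : exists L : l2 R I, forall i, L i = l i.
  by exists (x0 - g0) => i; rewrite l2DE l2NE g0E opprB addrC subrK.
apply/cvg_ex; exists L; apply/cvgrPdist_le => e e0.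
have eE : e = (complex.Re e)%:C.
  by rewrite RRe_real// ger0_real// ltW.
rewrite eE; move: e0; rewrite eE ltcR => e0; set r := complex.Re _ in e0 *.
have r2 : 0 < r / 2 by rewrite divr_gt0.
have [x [g [Fx gE gr]]] := key _ r2.
apply: filterS Fx => y /= xy.
have -> : L - y = (x - y) - g.
  by apply: l2P_eq => i; rewrite !l2DE !l2NE LE gE; ring.
apply: le_trans (ler_normB _ _) _.
apply: le_trans (lerD xy gr) _.
by rewrite -rmorphD /= -splitr.
Qed.

HB.instance Definition _ := Uniform_isComplete.Build (l2 R I) l2_complete.
End Ell2Complete.

Section Ell2Basis.
Variables (R : realType) (I : choiceType).

Lemma square_summable_delta (i : I) :
  (fun j => (j == i)%:R : R[i]) \in square_summable.
Proof.
rewrite unfold_in; apply: (rsum_le_bound _ (M := 1) _).1 => [j|s us].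
  exact: csqr_ge0.
rewrite (eq_bigr (fun j => (j == i)%:R)) => [|j _]; last first.
  by rewrite /csqr; case: (j == i) => /=; rewrite !expr0n ?expr1n /= addr0.
rewrite -natr_sum -[leRHS]/(1%:R) ler_nat.
have -> : (\sum_(j <- s) (j == i) = count_mem i s)%N.
  by rewrite -sum1_count [RHS]big_mkcond; apply: eq_bigr => j _ /=; case: (j == i).
by rewrite count_uniq_mem ?leq_b1.
Qed.

Definition l2_delta (i : I) : l2 R I := L2 (square_summable_delta i).

End Ell2Basis.

Section Operators.
Variable R : realType.

Definition bounded_operator (V W : hilbertType R) (T : V -> W) : Prop :=
  linear T /\ exists M : R, forall x, `|T x| <= M%:C * `|x|.

(* Stated as a relation: T has at most one such S, and exactly one when T is
   bounded. *)
Definition adjoint (V W : hilbertType R) (T : V -> W) (S : W -> V) : Prop :=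
  forall x y, inner (T x) y = inner x (S y).

Record cstar_subalgebra (V : hilbertType R) (A : set (V -> V)) : Prop := {
  cstar_bounded : A `<=` bounded_operator (V := V) (W := V);
  cstar_0 : A (fun=> 0);
  cstar_D : forall S T, A S -> A T -> A (fun x => S x + T x);
  cstar_Z : forall (c : R[i]) T, A T -> A (fun x => c *: T x);
  cstar_M : forall S T, A S -> A T -> A (S \o T);
  cstar_adj : forall S T, A S -> adjoint S T -> A T;
  cstar_closed : forall T, bounded_operator T ->
    (forall e : R, 0 < e ->
      exists2 S, A S & forall x, `|T x - S x| <= e%:C * `|x|) -> A T }.

Definition cstar_generated (V : hilbertType R) (G : set (V -> V)) :
  set (V -> V) := smallest (@cstar_subalgebra V) G.

(* pi is only constrained on A; its values elsewhere are irrelevant. *)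
Record nondegenerate_rep (V : hilbertType R) (A : set (V -> V))
    (H : hilbertType R) (pi : (V -> V) -> (H -> H)) : Prop := {
  rep_bounded : forall S, A S -> bounded_operator (pi S);
  rep_D : forall S T, A S -> A T ->
    pi (fun x => S x + T x) = (fun y => pi S y + pi T y);
  rep_Z : forall (c : R[i]) T, A T ->
    pi (fun x => c *: T x) = (fun y => c *: pi T y);
  rep_M : forall S T, A S -> A T -> pi (S \o T) = pi S \o pi T;
  rep_adj : forall S T, A S -> A T -> adjoint S T -> adjoint (pi S) (pi T);
  rep_nondegenerate : forall y, (forall S, A S -> pi S y = 0) -> y = 0 }.

Definition commutant (H : hilbertType R) (M : set (H -> H)) : set (H -> H) :=
  [set T | bounded_operator T /\ forall S, M S -> S \o T = T \o S].

Definition projection_in (H : hilbertType R) (M : set (H -> H)) (p : H -> H) :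
  Prop := [/\ M p, p \o p = p & adjoint p p].

Definition central_in (H : hilbertType R) (M : set (H -> H)) (z : H -> H) :
  Prop := M z /\ forall S, M S -> S \o z = z \o S.

Definition abelian_projection_in (H : hilbertType R) (M : set (H -> H))
  (p : H -> H) : Prop :=
  projection_in M p /\
  forall S T, M S -> M T ->
    (p \o S \o p) \o (p \o T \o p) = (p \o T \o p) \o (p \o S \o p).

(* Every nonzero central projection majorizes a nonzero abelian projection. *)
Definition type_I_von_Neumann (H : hilbertType R) (M : set (H -> H)) : Prop :=
  forall z, projection_in M z -> central_in M z -> z <> (fun=> 0) ->
    exists p, [/\ abelian_projection_in M p, p <> (fun=> 0) & z \o p = p].

(* A C*-algebra is of type I when the von Neumann algebra generated by each
   of its (nondegenerate) *-representations is of type I; that algebra is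
   the bicommutant of the image. *)
Definition type_I_cstar (V : hilbertType R) (A : set (V -> V)) : Prop :=
  forall (H : hilbertType R) (pi : (V -> V) -> (H -> H)),
    nondegenerate_rep A pi -> type_I_von_Neumann (commutant (commutant (pi @` A))).

End Operators.

Section WeaklyAntiMonotone.
Variable R : realType.

(* [path leq 1 [:: i_1; ...; i_k]] unfolds to 1 <= i_1 <= ... <= i_k. *)
Definition wam_word := {w : seq nat | path leq 1%N w}.

(* The word w labels the basis vector e_{i_1} (x) ... (x) e_{i_k}, and the
   empty word labels the vacuum vector. *)
Definition wam_fock := l2 R wam_word.

(* For a word w, [insub (i :: val w)] is a word exactly when i >= 1 and either w
   is empty or i is at most its first letter. *)
Definition is_creator (i : nat) (T : wam_fock -> wam_fock) : Prop :=
  bounded_operator T /\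
  forall w : wam_word,
    T (l2_delta R w) =
    if insub (i :: val w) is Some v then l2_delta R v else 0.

Lemma creator_exists (i : nat) : (1 <= i)%N -> exists T, is_creator i T.
Proof.
move=> i1.
pose tl (w : wam_word) : option wam_word :=
  if val w is j :: v then if j == i then insub v else None else None.
have tlP w v : tl w = Some v -> val w = i :: val v.
  rewrite /tl; case: (val w) => // j u; case: eqP => // ->.
  by case: insubP => // v' _ <- [->].
have tlE (w v : wam_word) : val w = i :: val v -> tl w = Some v.
  by rewrite /tl => ->; rewrite eqxx valK.
pose g (f : wam_fock) (w : wam_word) : R[i] := oapp f 0 (tl w).
have tlK : ocancel tl (fun v : wam_word => insubd v (i :: val v)).
  move=> w; case E : (tl w) => [v|]//=; apply/val_inj.
  by rewrite val_insubd -(tlP _ _ E) (valP w).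
have gs (f : wam_fock) (s : seq wam_word) : uniq s ->
    \sum_(w <- s) csqr (g f w) <= rsum (fun w => csqr (f w)).
  move=> us; have -> : \sum_(w <- s) csqr (g f w) = \sum_(v <- pmap tl s) csqr (f v).
    elim: s {us} => [|w s IH]; first by rewrite !big_nil.
    rewrite big_cons IH /=; case E : (tl w) => [v|] /=; rewrite /g E /=.
      by rewrite big_cons.
    by rewrite /csqr /= expr0n addr0 add0r.
  apply: rsum_ge_fin; [by move=> v; exact: csqr_ge0|exact: l2_summable|].
  exact: pmap_uniq tlK _ us.
have gP f : g f \in square_summable.
  exact: (rsum_le_bound (fun w => csqr_ge0 (g f w)) (gs f)).1.
exists (fun f => L2 (gP f)); split; first split.
- move=> k f h; apply: l2P_eq => w; rewrite l2DE l2ZE /= /g.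
  by case: (tl w) => [v|] //=; rewrite mulr0 addr0.
- exists 1 => f; rewrite rmorph1 mul1r.
  rewrite -(@ler_pXn2r _ 2%N)// ?nnegrE// !l2_sqr_norm lecR.
  exact: (rsum_le_bound (fun w => csqr_ge0 (g f w)) (gs f)).2.
- move=> w; apply: l2P_eq => u /=; rewrite /g.
  case: insubP => [v _ vE|nw].
    rewrite /=; case E : (tl u) => [u'|] /=.
      congr ((nat_of_bool _)%:R); apply/idP/idP => /eqP H; apply/eqP/val_inj.
        by rewrite vE (tlP _ _ E) H.
      by have := congr1 val H; rewrite vE (tlP _ _ E) => -[].
    case: eqP => // uv; move: E; rewrite (tlE u w)//.
    by rewrite uv vE.
  case E : (tl u) => [u'|] //=; case: eqP => // uw; move: nw.
  by rewrite -uw -(tlP _ _ E) (valP u).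
Qed.

Definition wam_generators : set (wam_fock -> wam_fock) :=
  [set T | exists2 i : nat, (1 <= i)%N &
    is_creator i T \/ exists2 S, is_creator i S & adjoint S T].

Definition wam_algebra : set (wam_fock -> wam_fock) :=
  cstar_generated wam_generators.

End WeaklyAntiMonotone.

Arguments wam_generators R : clear implicits.
Arguments wam_algebra R : clear implicits.

(* Main.v *)
Require Import Defs.
From mathcomp Require Import all_boot all_order all_algebra.
From mathcomp Require Import complex ring lra.
From mathcomp Require Import boolp classical_sets cardinality fsbigop.
From mathcomp Require Import reals ereal topology normedtype esum.

(** Let the multiplicity n_i of the letter i+1 describe a weakly increasing word.
The Fock space then becomes the infinite tensor product of copies of l^2(N),
one for each site i, along the vacuum vector e_0, and the creator of letter
i+1 is P (x) ... (x) P (x) S (x) 1 (x) ..., with P the projection on e_0 at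
the sites before i and S the shift at site i. Such a formula makes sense on any
other infinite product, so the algebra has many representations that look
locally like the defining one; one of them generates a von Neumann algebra
without abelian projections.

That representation lives on F (x) F, F being the Fock space, but with the
reference vector e_0 (x) e_0 of each site replaced by the entangled vector
xi = (e_0 (x) e_0 + e_1 (x) e_1) / sqrt 2. An involutive unitary [site_rot j]
turns e_0 (x) e_0 into xi at site j. With U_k the product of the first k of
them, an operator T of the algebra is represented by the limit of
U_k (1 (x) T) U_k^-1. The generators involve finitely many sites, so for them
the sequence is eventually constant; hence it converges in norm on the whole
algebra ([wam_convergent]), and nothing has to be said about relations between
the generators ([wam_rep_nondegenerate]).

Let M be the bicommutant of the image, and let X_n and Z_n be the matrix units
e_00 and e_10 of the second leg at site n. They belong to M
([bicommutant_tail]). On xi they act as the matrix units e_00 and e_01 of the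
first leg, which commute with the representation ([commutant_on1]), and every
vector of F (x) F looks like xi at far sites ([vacproj_strong]). Therefore X_n
and Z_n commute strongly, in the limit, with each element p of M
([asymptotically_central]).

Now let p be an abelian projection of M and z = p z. Since X_n Z_n = 0 and
Z_n X_n = Z_n, the vector p X_n p Z_n p z is almost 0 while p Z_n p X_n p z is
almost Z_n z. The two are equal, so Z_n z tends to 0
([abelian_almost_kills]). But Z_n keeps the fraction 1 / sqrt 2 of the norm of
a vector that looks like xi at site n ([tail_raise_lower_bound]), so z = 0.
The identity is thus a nonzero central projection of M above no nonzero
abelian projection. *)

Set Implicit Arguments.
Unset Strict Implicit.
Unset Printing Implicit Defensive.

Import Order.TTheory GRing.Theory Num.Theory.
Import numFieldNormedType.Exports.

Local Open Scope classical_set_scope.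
Local Open Scope ring_scope.
Local Open Scope complex_scope.

(** * Norms with real values, adjoints and limits *)

Lemma Re_norm_ge0 (R : realType) (c : R[i]) : 0 <= complex.Re `|c|.
Proof. by rewrite -lecR; exact: (normr_ge0 c). Qed.

Lemma Re_normD (R : rcfType) (a b : R[i]) :
  complex.Re `|a + b| <= complex.Re `|a| + complex.Re `|b|.
Proof. by rewrite -lecR rmorphD; exact: (ler_normD a b). Qed.

Lemma Re_norm_le0_eq0 (R : realType) (c : R[i]) : complex.Re `|c| <= 0 -> c = 0.
Proof.
move=> c0; apply/eqP; rewrite -normr_eq0.
suff : complex.Re `|c| = 0 by rewrite -[X in X == _]/((complex.Re `|c|)%:C) => ->.
by apply/eqP; rewrite eq_le c0 Re_norm_ge0.
Qed.

Lemma half_mul (R : realType) (e x : R) : e * x = e / 2 * x + e / 2 * x.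
Proof. by rewrite -mulrDl -splitr. Qed.

Section RealNorm.
Variables (R : realType) (V : hilbertType R).
Implicit Types (x y : V) (e : R).

(** Real-valued, so that estimates are made in the ordered field [R] and not
in [R[i]]. *)
Definition nrm (x : V) : R := complex.Re `|x|.

Lemma nrmE x : `|x| = (nrm x)%:C.
Proof. by rewrite /nrm RRe_real// ger0_real. Qed.

Lemma nrm_ge0 x : 0 <= nrm x.
Proof. by rewrite -lecR -nrmE normr_ge0. Qed.

Lemma nrmD x y : nrm (x + y) <= nrm x + nrm y.
Proof. by rewrite -lecR rmorphD /= -!nrmE ler_normD. Qed.

Lemma nrmN x : nrm (- x) = nrm x.
Proof. by rewrite /nrm normrN. Qed.

Lemma nrmB x y : nrm (x - y) <= nrm x + nrm y.
Proof. by rewrite -[nrm y]nrmN nrmD. Qed.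

Lemma nrmBC x y : nrm (x - y) = nrm (y - x).
Proof. by rewrite -nrmN opprB. Qed.

Lemma nrm_trans y x z : nrm (x - z) <= nrm (x - y) + nrm (y - z).
Proof. by rewrite -[in leLHS](subrK y x) -addrA nrmD. Qed.

Lemma nrm0 : nrm 0 = 0.
Proof. by rewrite /nrm normr0. Qed.

Lemma nrm0_eq0 x : nrm x = 0 -> x = 0.
Proof. by move=> x0; apply/normr0_eq0; rewrite nrmE x0. Qed.

Lemma nrm_le0_eq0 x : nrm x <= 0 -> x = 0.
Proof. by move=> x0; apply: nrm0_eq0; apply/eqP; rewrite eq_le x0 nrm_ge0. Qed.

Lemma nrmZ (c : R[i]) x : nrm (c *: x) = complex.Re `|c| * nrm x.
Proof.
apply/complexI; rewrite -nrmE normrZ nrmE rmorphM /=; congr (_ * _).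
Qed.

Lemma nrm_sub_eq x y : (forall e, 0 < e -> nrm (x - y) <= e) -> x = y.
Proof.
move=> H; apply/eqP; rewrite -subr_eq0; apply/eqP/nrm_le0_eq0.
by apply/ler_addgt0Pl => e e0; rewrite addr0; exact: H.
Qed.

Lemma nrm_sqr x : ((nrm x) ^+ 2)%:C = inner x x.
Proof. by rewrite -sqr_normE nrmE rmorphXn. Qed.

Lemma inner_nondeg x y : (forall z, inner z x = inner z y) -> x = y.
Proof.
move=> H; apply/eqP; rewrite -subr_eq0; apply/eqP/nrm0_eq0/eqP.
rewrite -(sqrf_eq0 (nrm _)); apply/eqP/complexI.
by rewrite nrm_sqr linearB /= H subrr.
Qed.

Lemma nrm_cauchy (u : nat -> V) :
  (forall e, 0 < e -> exists N, forall k l, (N <= k)%N -> (N <= l)%N ->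
     nrm (u k - u l) <= e) ->
  exists x, forall e, 0 < e -> exists N, forall k, (N <= k)%N ->
     nrm (u k - x) <= e.
Proof.
move=> H.
have cu : cvg (u @ \oo).
  apply: cauchy_cvg; apply/cauchyP => e e0.
  have eE : e = (complex.Re e)%:C by rewrite RRe_real// ger0_real// ltW.
  move: e0; rewrite eE ltcR => e0; set r := complex.Re e in e0 *.
  have [|N HN] := H (r / 2); first by rewrite divr_gt0.
  exists (u N); exists N => // k /= Nk; rewrite -ball_normE /=.
  rewrite nrmE ltcR; apply: le_lt_trans (HN _ _ (leqnn N) Nk) _.
  by rewrite ltr_pdivrMr// ltr_pMr// ltr1n.
move/cvg_ex: cu => [x /cvgrPdist_le xu]; exists x => e e0.
have [|N _ HN] := xu e%:C; first by rewrite ltcR.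
exists N => k Nk; have := HN k Nk; rewrite /= nrmE lecR.
by rewrite nrmBC.
Qed.

End RealNorm.

Section BoundedOperators.
Variable R : realType.
Implicit Types V W : hilbertType R.

Definition bounded_by V W (T : V -> W) (M : R) := forall x, nrm (T x) <= M * nrm x.

Lemma bounded_byW V W (T : V -> W) M N : M <= N -> bounded_by T M -> bounded_by T N.
Proof. by move=> MN H x; rewrite (le_trans (H x))// ler_wpM2r// nrm_ge0. Qed.

Lemma bopP V W (T : V -> W) :
  bounded_operator T <-> linear T /\ exists2 M, 0 < M & bounded_by T M.
Proof.
split=> -[lT [M]].
  move=> HM; split=> //; exists (Num.max M 1); first by rewrite lt_max ltr01 orbT.
  apply: (@bounded_byW _ _ _ M); first by rewrite le_max lexx.
  by move=> x; rewrite -lecR rmorphM /= -!nrmE.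
by move=> M0 HM; split=> //; exists M => x; rewrite !nrmE -rmorphM lecR; exact: HM.
Qed.

Lemma linopD V W (T : V -> W) x y : linear T -> T (x + y) = T x + T y.
Proof. by move=> lT; have := lT 1 x y; rewrite !scale1r. Qed.

Lemma linop0 V W (T : V -> W) : linear T -> T 0 = 0.
Proof.
by move=> lT; apply: (addrI (T 0)); rewrite addr0 -(linopD _ _ lT) addr0.
Qed.

Lemma linopZ V W (T : V -> W) c x : linear T -> T (c *: x) = c *: T x.
Proof. by move=> lT; have := lT c x 0; rewrite !addr0 (linop0 lT) addr0. Qed.

Lemma linopB V W (T : V -> W) x y : linear T -> T (x - y) = T x - T y.
Proof.
by move=> lT; rewrite (linopD _ _ lT) -scaleN1r (linopZ _ _ lT) scaleN1r.
Qed.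

Lemma bop_comp V W (Z : hilbertType R) (S : W -> Z) (T : V -> W) :
  bounded_operator S -> bounded_operator T -> bounded_operator (S \o T).
Proof.
move=> /bopP[lS [M M0 HM]] /bopP[lT [N N0 HN]]; apply/bopP; split.
  by move=> a x y /=; rewrite lT lS.
exists (M * N); first exact: mulr_gt0.
by move=> x /=; rewrite (le_trans (HM _))// -mulrA ler_pM2l// HN.
Qed.

Lemma bopD V W (S T : V -> W) :
  bounded_operator S -> bounded_operator T -> bounded_operator (fun x => S x + T x).
Proof.
move=> /bopP[lS [M M0 HM]] /bopP[lT [N N0 HN]]; apply/bopP; split.
  by move=> a x y /=; rewrite lT lS scalerDr addrACA.
exists (M + N); first exact: addr_gt0.
move=> x /=; rewrite (le_trans (nrmD _ _))// mulrDl.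
by have := HM x; have := HN x; lra.
Qed.

Lemma bopZ V W (c : R[i]) (T : V -> W) :
  bounded_operator T -> bounded_operator (fun x => c *: T x).
Proof.
move=> /bopP[lT [N N0 HN]]; apply/bopP; split.
  by move=> a x y /=; rewrite lT scalerDr !scalerA mulrC.
have c0 : 0 <= complex.Re `|c| by exact: Re_norm_ge0.
exists (complex.Re `|c| * N + 1); first by rewrite ltr_wpDl ?mulr_ge0// ltW.
move=> x /=; rewrite nrmZ mulrDl mul1r ler_wpDr ?nrm_ge0//.
by rewrite -mulrA ler_wpM2l.
Qed.

Lemma bop0 V W : bounded_operator (fun _ : V => 0 : W).
Proof.
apply/bopP; split; first by move=> a x y; rewrite scaler0 addr0.
by exists 1 => // x; rewrite nrm0 mul1r nrm_ge0.
Qed.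

Lemma bop_id V : bounded_operator (fun x : V => x).
Proof. by apply/bopP; split=> //; exists 1 => // x; rewrite mul1r. Qed.

Lemma innerC V (x y : V) : inner x y = Num.conj (inner y x).
Proof. by have := @hermC _ _ _ _ (@inner R V) x y; rewrite expr0 mul1r. Qed.

Lemma innerBl V (x y z : V) :
  inner (x - y) z = inner x z - inner y z.
Proof. by rewrite linearBl. Qed.

Lemma innerBr V (x y z : V) :
  inner x (y - z) = inner x y - inner x z.
Proof. by rewrite linearBr. Qed.

Lemma adjointC V W (T : V -> W) S : adjoint T S -> adjoint S T.
Proof.
by move=> H x y; rewrite innerC -H -innerC.
Qed.

Lemma adjoint_comp V W (Z : hilbertType R) (S : W -> Z) S' (T : V -> W) T' :
  adjoint S S' -> adjoint T T' -> adjoint (S \o T) (T' \o S').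
Proof. by move=> HS HT x y /=; rewrite HS HT. Qed.

Lemma adjointB V W (S T : V -> W) S' T' :
  adjoint S S' -> adjoint T T' -> adjoint (fun x => S x - T x) (fun x => S' x - T' x).
Proof. by move=> HS HT x y /=; rewrite linearBl /= linearBr /= HS HT. Qed.

Lemma adjoint_uniq V W (T : V -> W) S S' : adjoint T S -> adjoint T S' -> S = S'.
Proof.
by move=> H H'; apply/funext => y; apply: inner_nondeg => x; rewrite -H -H'.
Qed.

Lemma adjoint_linear V W (T : V -> W) S : adjoint T S -> linear S.
Proof.
move=> H a x y; apply: inner_nondeg => z.
by rewrite -H !linearD /= !linearZ /= !H.
Qed.

Lemma inner_le V (x y : V) : complex.Re `|inner x y| <= nrm x * nrm y.
Proof.
have i0 : 0 <= complex.Re `|inner x y| by exact: Re_norm_ge0.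
rewrite -(@ler_pXn2r _ 2%N)// ?nnegrE ?mulr_ge0 ?nrm_ge0//.
rewrite -lecR exprMn [X in _ <= X]rmorphM/= !nrm_sqr rmorphXn /=.
exact: dot_CauchySchwarz.
Qed.

(** The square of the norm of S y is the inner product of T (S y) with y. *)
Lemma adjoint_bounded_by V W (T : V -> W) S M : 0 <= M -> bounded_by T M ->
  adjoint T S -> bounded_by S M.
Proof.
move=> M0 HT H y; have [->|Sy0] := eqVneq (S y) 0.
  by rewrite nrm0 mulr_ge0// nrm_ge0.
have Sy : 0 < nrm (S y).
  rewrite lt_neqAle nrm_ge0 andbT eq_sym; apply: contra Sy0 => /eqP.
  by move/nrm0_eq0 => ->.
rewrite -(ler_pM2l Sy) -expr2.
have -> : nrm (S y) ^+ 2 = complex.Re `|inner (T (S y)) y|.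
  rewrite H -nrm_sqr ger0_norm ?ler0c ?exprn_ge0 ?nrm_ge0//.
apply: le_trans (inner_le _ _) _.
by rewrite mulrA [_ * M]mulrC ler_wpM2r ?nrm_ge0.
Qed.

Lemma adjoint_bop V W (T : V -> W) S :
  bounded_operator T -> adjoint T S -> bounded_operator S.
Proof.
move=> /bopP[lT [M M0 HM]] H; apply/bopP; split; first exact: adjoint_linear H.
by exists M => //; apply: adjoint_bounded_by H => //; exact: ltW.
Qed.

End BoundedOperators.

Section Limits.
Variables (R : realType) (V : hilbertType R).
Implicit Types (u v : nat -> V) (x y : V).

Definition tends u x :=
  forall e : R, 0 < e -> exists N, forall k, (N <= k)%N -> nrm (u k - x) <= e.

Lemma tends_ev u v x N :
  (forall k, (N <= k)%N -> u k = v k) -> tends u x -> tends v x.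
Proof.
move=> uv ux e e0; have [M HM] := ux e e0; exists (maxn N M) => k.
by rewrite geq_max => /andP[Nk Mk]; rewrite -uv// HM.
Qed.

Lemma tends_bound u x M : tends u x -> (forall k, nrm (u k) <= M) -> nrm x <= M.
Proof.
move=> ux uM; apply/ler_addgt0Pr => e e0; have [N HN] := ux e e0.
have := nrmD (x - u N) (u N); rewrite subrK nrmBC.
by have := HN N (leqnn N); have := uM N; lra.
Qed.

Lemma tendsD u v x y : tends u x -> tends v y -> tends (fun k => u k + v k) (x + y).
Proof.
move=> ux vy e e0; have e2 : 0 < e / 2 by rewrite divr_gt0.
have [N HN] := ux _ e2; have [M HM] := vy _ e2.
exists (maxn N M) => k; rewrite geq_max => /andP[/HN h1 /HM h2].
rewrite opprD addrACA; apply: le_trans (nrmD _ _) _.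
by rewrite [leRHS]splitr lerD.
Qed.

Lemma tends_lin (W : hilbertType R) (T : V -> W) u x : bounded_operator T -> tends u x ->
  forall e : R, 0 < e -> exists N, forall k, (N <= k)%N -> nrm (T (u k) - T x) <= e.
Proof.
move=> /bopP[lT [M M0 HM]] ux e e0; have [|N HN] := ux (e / M); first by rewrite divr_gt0.
exists N => k Nk; rewrite -(linopB _ _ lT); apply: le_trans (HM _) _.
by apply: le_trans (ler_wpM2l (ltW M0) (HN _ Nk)) _; rewrite mulrC divfK// gt_eqF.
Qed.

Lemma tendsZ u x c : tends u x -> tends (fun k => c *: u k) (c *: x).
Proof. exact: (tends_lin (bopZ c (bop_id V))). Qed.

Lemma tends_uniq u x y : tends u x -> tends u y -> x = y.
Proof.
move=> ux uy; apply: nrm_sub_eq => e e0; have e2 : 0 < e / 2 by rewrite divr_gt0.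
have [N HN] := ux _ e2; have [M HM] := uy _ e2.
apply: le_trans (nrm_trans (u (maxn N M)) _ _) _; rewrite [leRHS]splitr nrmBC lerD//.
  by apply: HN; rewrite leq_maxl.
by apply: HM; rewrite leq_maxr.
Qed.

End Limits.

(** * Square-summable families and their basis vectors *)

Section Energy.
Variables (R : realType) (I : choiceType).
Implicit Types (f g : I -> R[i]).

(** The squared l^2 norm of an arbitrary family, infinite values allowed: it
lets sums be rearranged before any summability is known. *)
Definition energy f : \bar R := \esum_(i in [set: I]) (csqr (f i))%:E.

Lemma energy_ge0 f : (0 <= energy f)%E.
Proof. by apply: esum_ge0 => i _; rewrite lee_fin csqr_ge0. Qed.

Lemma energy_l2 (f : l2 R I) : energy f = ((nrm f) ^+ 2)%:E.
Proof.
have sf := l2_summable f.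
have -> : (nrm f) ^+ 2 = rsum (fun i => csqr (f i)).
  by apply/complexI; rewrite -l2_sqr_norm nrmE rmorphXn.
rewrite rsum_ge0E => [|i]; last exact: csqr_ge0.
rewrite fineK// ge0_fin_numE ?energy_ge0//.
by rewrite rsummable_ge0E// in sf => i; exact: csqr_ge0.
Qed.

(** Total, with value 0 on families that are not square-summable; this spares
a summability proof in each definition of an operator. *)
Definition mkl2 f : l2 R I := insubd (0 : l2 R I) f.

Lemma mkl2E f : (energy f < +oo)%E -> mkl2 f =1 f.
Proof.
move=> ef i; have sf : f \in square_summable.
  by rewrite unfold_in /square_summable rsummable_ge0E// => j; exact: csqr_ge0.
by rewrite /mkl2 /insubd insubT.
Qed.

End Energy.

Lemma nrm_le_energy (R : realType) (I J : choiceType) (f : l2 R I) (g : l2 R J) (M : R) :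
  0 <= M -> (energy f <= (M ^+ 2)%:E * energy g)%E -> nrm f <= M * nrm g.
Proof.
move=> M0; rewrite !energy_l2 -EFinM lee_fin -exprMn.
by rewrite ler_pXn2r// nnegrE ?mulr_ge0 ?nrm_ge0.
Qed.

Section Density.
Variables (R : realType) (I : choiceType).
Implicit Types (f g : l2 R I).

Lemma l2_sumE (s : seq I) (F : I -> l2 R I) x : (\sum_(i <- s) F i) x = \sum_(i <- s) F i x.
Proof. by elim: s => [|i s IH]; rewrite ?big_nil// !big_cons l2DE IH. Qed.

(** A finite set carrying all of the total mass of [f] but [e ^+ 2] leaves a
remainder of norm at most [e]. *)
Lemma l2_approx f (e : R) : 0 < e ->
  exists s : seq I, nrm (f - \sum_(i <- s) f i *: l2_delta R i) <= e.
Proof.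
move=> e0; pose tot := rsum (fun i => csqr (f i)).
have c0 i : 0 <= csqr (f i) by exact: csqr_ge0.
have [s us sbig] : exists2 s : seq I, uniq s & tot - e ^+ 2 < \sum_(i <- s) csqr (f i).
  apply: contrapT => H.
  have := (@rsum_le_bound _ _ (fun i => csqr (f i)) (tot - e ^+ 2) c0 _).2.
  rewrite -/tot => /(_ _)/wrap[s us|]; last by have := exprn_gt0 2 e0; lra.
  by rewrite leNgt; apply/negP => sbig; apply: H; exists s.
exists s; move gdef: (f - _) => g.
have gE x : g x = if x \in s then 0 else f x.
  rewrite -gdef l2DE l2NE l2_sumE.
  under eq_bigr do rewrite l2ZE /=.
  case: ifPn => xs.
    rewrite (bigD1_seq x)//= eqxx mulr1 big1_seq ?addr0 ?subrr// => i /andP[ix _].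
    by rewrite eq_sym (negbTE ix) mulr0.
  rewrite big1_seq ?subr0// => i /andP[_ si].
  by case: eqP xs => [->|_ _]; rewrite ?si// mulr0.
have [||sg le_g] := @rsum_le_bound _ _ (fun i => csqr (g i)) (e ^+ 2).
- by move=> i; exact: csqr_ge0.
- move=> t ut.
  have -> : \sum_(i <- t) csqr (g i) = \sum_(i <- t | i \notin s) csqr (f i).
    rewrite [RHS]big_mkcond /=; apply: eq_bigr => i _; rewrite gE.
    by case: (i \in s) => //=; rewrite /csqr /= expr0n addr0.
  have := @rsum_ge_fin _ _ _ (s ++ [seq i <- t | i \notin s]) c0 (l2_summable f).
  rewrite cat_uniq us filter_uniq//= andbT => /(_ _)/wrap[|].
    by apply/hasPn => i; rewrite mem_filter => /andP[].
  rewrite big_cat big_filter /= -/tot; lra.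
rewrite -lecR -nrmE l2_norm_le//; exact: ltW.
Qed.

(** Finite combinations of basis vectors are dense: the induction principle
through which every identity and every estimate is reduced to basis vectors.
*)
Lemma l2_ind (P : l2 R I -> Prop) :
  P 0 -> (forall c x f, P f -> P (c *: l2_delta R x + f)) ->
  (forall f, (forall e : R, 0 < e -> exists2 g, P g & nrm (f - g) <= e) -> P f) ->
  forall f, P f.
Proof.
move=> P0 PD Pl f; apply: Pl => e e0; have [s sbig] := l2_approx f e0.
exists (\sum_(i <- s) f i *: l2_delta R i) => //.
by elim: s {sbig} => [|i s IH]; rewrite ?big_nil// big_cons; exact: PD.
Qed.

Lemma bop_eq (V : hilbertType R) (S T : l2 R I -> V) :
  bounded_operator S -> bounded_operator T ->
  (forall x, S (l2_delta R x) = T (l2_delta R x)) -> S = T.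
Proof.
move=> /bopP[lS [M M0 HM]] /bopP[lT [N N0 HN]] ST; apply/funext.
apply: l2_ind => [|c x f IH|f H]; first by rewrite !linop0.
  by rewrite lS lT ST IH.
apply: nrm_sub_eq => e e0.
have [|g gP fg] := H (e / (M + N)); first by rewrite divr_gt0// addr_gt0.
have -> : S f - T f = S (f - g) - T (f - g).
  by rewrite (linopB _ _ lS) (linopB _ _ lT) gP opprB addrA subrK.
apply: le_trans (nrmB _ _) _.
have h1 := le_trans (HM (f - g)) (ler_wpM2l (ltW M0) fg).
have h2 := le_trans (HN (f - g)) (ler_wpM2l (ltW N0) fg).
apply: le_trans (lerD h1 h2) _.
by rewrite -mulrDl mulrC divfK// gt_eqF// addr_gt0.
Qed.

(** Basis vectors span a dense subspace, and the uniform bound carries the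
convergence over to its closure. *)
Lemma strong_delta (V : hilbertType R) (T : nat -> l2 R I -> V) (M : R) :
  (forall n, linear (T n)) -> 0 < M -> (forall n, bounded_by (T n) M) ->
  (forall x, exists N, forall n, (N <= n)%N -> T n (l2_delta R x) = 0) ->
  forall f e, 0 < e -> exists N, forall n, (N <= n)%N -> nrm (T n f) <= e.
Proof.
move=> lT M0 HM Hx; apply: l2_ind => [e e0|c x f IH e e0|f H e e0].
- by exists 0%N => n _; rewrite linop0// nrm0 ltW.
- have [N1 H1] := Hx x; have [N2 H2] := IH e e0.
  exists (maxn N1 N2) => n; rewrite geq_max => /andP[n1 n2].
  by rewrite lT H1// scaler0 add0r H2.
have [|g gP fg] := H (e / 2 / M); first by rewrite !divr_gt0.
have [|N HN] := gP (e / 2); first by rewrite divr_gt0.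
exists N => n nN; rewrite -(subrK g f) linopD//.
apply: le_trans (nrmD _ _) _; rewrite [leRHS]splitr lerD ?HN//.
apply: le_trans (HM _ _) _; apply: le_trans (ler_wpM2l (ltW M0) fg) _.
by rewrite mulrC divfK// gt_eqF.
Qed.

Lemma rsum_delta (a : R) (i : I) : rsum (fun j => a * (j == i)%:R) = a.
Proof.
have d0 j : 0 <= (j == i)%:R :> R by [].
have sq j : csqr ((j == i)%:R : R[i]) = (j == i)%:R.
  by rewrite /csqr; case: (j == i) => /=; rewrite !expr0n ?expr1n /= addr0.
have sd : rsummable (fun j => (j == i)%:R : R).
  have := l2_summable (l2_delta R i); congr (is_true (rsummable _)).
  by apply/funext => j /=; rewrite sq.
rewrite rsumZ//; have -> : rsum (fun j => (j == i)%:R : R) = 1; last by rewrite mulr1.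
apply/eqP; rewrite eq_le; apply/andP; split; last first.
  have := @rsum_ge_fin _ _ _ [:: i] d0 sd isT.
  by rewrite big_seq1 eqxx.
apply: (rsum_le_bound d0 _).2 => s us.
rewrite -natr_sum -[leRHS]/(1%:R) ler_nat.
have -> : (\sum_(j <- s) (j == i) = count_mem i s)%N.
  by rewrite -sum1_count [RHS]big_mkcond; apply: eq_bigr => j _ /=; case: (j == i).
by rewrite count_uniq_mem ?leq_b1.
Qed.

Lemma inner_delta f x : inner f (l2_delta R x) = f x.
Proof.
rewrite -[LHS]/(l2_inner f (l2_delta R x)) /l2_inner /csum /=.
have E (i : I) : f i * ((i == x)%:R)^*%C =
    complex.Re (f x) * (i == x)%:R +i* (complex.Im (f x) * (i == x)%:R).
  have [->|_] := eqVneq i x; first by rewrite conjc1 !mulr1; case: (f x).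
  by rewrite conjc0 !mulr0.
under [X in rsum X +i* _]eq_fun do rewrite E.
under [X in _ +i* rsum X]eq_fun do rewrite E.
by rewrite !rsum_delta; case: (f x).
Qed.

Lemma l2_delta_neq0 (x : I) : l2_delta R x <> 0.
Proof.
by move=> /(congr1 (fun f : l2 R I => f x)) /=; rewrite eqxx => /eqP; rewrite oner_eq0.
Qed.

End Density.

Section Adjoint.
Variable (R : realType).

Lemma functional_eq0 (I : choiceType) (phi : l2 R I -> R[i]) (K : R) :
  (forall a x y, phi (a *: x + y) = a * phi x + phi y) ->
  0 < K -> (forall f, complex.Re `|phi f| <= K * nrm f) ->
  (forall x, phi (l2_delta R x) = 0) -> forall f, phi f = 0.
Proof.
move=> lphi K0 HK Hx.
apply: l2_ind => [|c x f IH|f H].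
- by have := lphi (-1) 0 0; rewrite scaler0 addr0 mulN1r addNr.
- by rewrite lphi Hx IH mulr0 addr0.
apply: Re_norm_le0_eq0; apply/ler_addgt0Pl => e e0; rewrite addr0.
have [|g gP fg] := H (e / K); first by rewrite divr_gt0.
rewrite -(subrK g f) -[f - g]scale1r lphi mul1r gP addr0.
apply: le_trans (HK _) _; apply: le_trans (ler_wpM2l (ltW K0) fg) _.
by rewrite mulrC divfK// gt_eqF.
Qed.

(** For a fixed [y], both sides are bounded functionals of [f]. *)
Lemma inner_functional (V : hilbertType R) (I : choiceType) (S : l2 R I -> V) (T : V -> l2 R I) y :
  bounded_operator S ->
  (forall x, inner (S (l2_delta R x)) y = inner (l2_delta R x) (T y)) ->
  forall f, inner (S f) y = inner f (T y).
Proof.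
move=> /bopP[lS [M M0 HM]] H f; apply/eqP; rewrite -subr_eq0; apply/eqP.
pose phi f := inner (S f) y - inner f (T y); rewrite -/(phi f).
apply: (@functional_eq0 _ phi (M * nrm y + nrm (T y) + 1)).
- move=> a u v; rewrite /phi lS !linearDl /= !linearZl_LR /=.
  by rewrite mulrBr opprD addrACA.
- by rewrite ltr_wpDl// addr_ge0 ?mulr_ge0 ?nrm_ge0// ltW.
- move=> g; apply: le_trans (Re_normD _ _) _; rewrite normrN.
  apply: le_trans (lerD (inner_le _ _) (inner_le _ _)) _.
  have := ler_wpM2r (nrm_ge0 y) (HM g); have := nrm_ge0 g; nra.
- by move=> x; rewrite /phi H subrr.
Qed.

Lemma adjoint_delta (I J : choiceType) (S : l2 R I -> l2 R J) (T : l2 R J -> l2 R I) :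
  bounded_operator S -> bounded_operator T ->
  (forall x y, S (l2_delta R x) y = Num.conj (T (l2_delta R y) x)) ->
  adjoint S T.
Proof.
move=> bS bT ST f y; move: f; apply: inner_functional => // x.
rewrite innerC [RHS]innerC; congr Num.conj; apply/esym.
apply: (inner_functional (T := S)) => // z.
by rewrite inner_delta [RHS]innerC inner_delta ST conjCK.
Qed.

Lemma adjoint_deltaE (I J : choiceType) (S : l2 R I -> l2 R J) (T : l2 R J -> l2 R I) x y :
  adjoint S T -> S (l2_delta R x) y = Num.conj (T (l2_delta R y) x).
Proof. by move=> ST; rewrite -inner_delta ST innerC inner_delta. Qed.

End Adjoint.

(** * Operators induced by partial injections of the basis *)

Section Pull.
Variable (R : realType).

Definition partial_inj (I J : Type) (h : I -> option J) :=
  forall x y z, h x = Some z -> h y = Some z -> x = y.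

(** A partial injection [h] of index sets acts by composition. On basis
vectors it goes backwards: the basis vector of [y] is sent to that of the
preimage of [y] under [h], if there is one. *)
Definition pull (I J : choiceType) (h : I -> option J) (f : l2 R J) : l2 R I :=
  mkl2 (fun x => oapp f 0 (h x)).

(** Distinct indices read distinct entries of [f], each at most once. *)
Lemma energy_pull (I J : choiceType) (h : I -> option J) (f : J -> R[i]) :
  partial_inj h -> (energy (fun x => oapp f 0%R (h x)) <= energy f)%E.
Proof.
move=> hi; apply: ge_ereal_sup => _ [X [finX _] <-].
rewrite fsbig_finite//=; have us := finmap.fset_uniq (fset_set X).
move: (finmap.enum_fset _) us => s us.
have -> : (\sum_(x <- s) (csqr (oapp f 0%R (h x)))%:E =
           \sum_(y <- pmap h s) (csqr (f y))%:E)%E.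
  elim: s {us} => [|x s IH]; first by rewrite !big_nil.
  rewrite big_cons IH /=; case: (h x) => [y|] /=; first by rewrite big_cons.
  by rewrite /csqr /= expr0n addr0 add0e.
apply: esum_ge; exists [set` pmap h s] => //.
have uh : uniq (pmap h s).
  move: us.
  elim: s => //= x s IH /andP[xs us]; case E : (h x) => [y|] /=; last exact: IH.
  rewrite IH// andbT mem_pmap; apply: contra xs => /mapP[z zs hz].
  by rewrite (hi x z y).
by rewrite fsbig_seq.
Qed.

Section PullTheory.
Variables (I J : choiceType) (h : I -> option J).
Hypothesis hi : partial_inj h.

Lemma pullE (f : l2 R J) x : pull h f x = oapp f 0 (h x).
Proof. by rewrite mkl2E// (le_lt_trans (energy_pull _ hi))// energy_l2 ltry. Qed.

Lemma pull_linear : linear (pull h).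
Proof.
move=> a f g; apply: l2P_eq => x; rewrite l2DE l2ZE !pullE.
by case: (h x) => //=; rewrite mulr0 addr0.
Qed.

Lemma pull_bounded_by : bounded_by (pull h) 1.
Proof.
move=> f; apply: nrm_le_energy => //; rewrite expr1n mul1e.
apply: le_trans _ (energy_pull f hi); apply: le_esum => x _.
by rewrite pullE.
Qed.

Lemma pull_bop : bounded_operator (pull h).
Proof. by apply/bopP; split; [exact: pull_linear|exists 1 => //; exact: pull_bounded_by]. Qed.

End PullTheory.

Definition partial_inv (I J : Type) (h : I -> option J) (k : J -> option I) :=
  forall x y, h x = Some y <-> k y = Some x.

Lemma partial_invC (I J : Type) (h : I -> option J) k : partial_inv h k -> partial_inv k h.
Proof. by move=> hk x y; split=> /hk. Qed.

Lemma partial_inv_inj (I J : Type) (h : I -> option J) k : partial_inv h k -> partial_inj h.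
Proof. by move=> hk x y z /hk xz /hk; rewrite xz => -[]. Qed.

Lemma pull_delta (I J : choiceType) (h : I -> option J) k y : partial_inv h k ->
  pull h (l2_delta R y) = if k y is Some x then l2_delta R x else 0.
Proof.
move=> hk; apply: l2P_eq => x; rewrite (pullE (partial_inv_inj hk)).
case E : (k y) => [x'|] /=.
  case F : (h x) => [y'|] /=.
    case: (eqVneq y' y) => [y'y|ny].
      by move: F; rewrite y'y => /hk; rewrite E => -[->]; rewrite eqxx.
    case: eqVneq => // xx; move: F; rewrite xx.
    by move/hk: E => -> [yy]; rewrite yy eqxx in ny.
  by case: eqVneq => // xx; move/hk: E; rewrite -xx F.
case F : (h x) => [y'|] //=; case: eqVneq => // yy.
by move: F; rewrite yy => /hk; rewrite E.
Qed.

Lemma pull_adjoint (I J : choiceType) (h : I -> option J) k : partial_inv h k ->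
  adjoint (pull h) (pull k).
Proof.
move=> hk; have kh := partial_invC hk.
apply: adjoint_delta => [||y x]; [exact/pull_bop/partial_inv_inj|exact/pull_bop/partial_inv_inj|].
rewrite (pullE (partial_inv_inj hk)) (pullE (partial_inv_inj kh)).
case E : (h x) => [y'|] /=; case F : (k y) => [x'|] /=; rewrite ?rmorph0 ?rmorph_nat//.
- congr (nat_of_bool _)%:R; apply/eqP/eqP => H.
    by move/hk: E; rewrite H F => -[].
  by move/kh: F; rewrite H E => -[].
- case: eqVneq => // yy; by move/hk: E; rewrite yy F.
- case: eqVneq => // xx; by move/kh: F; rewrite xx E.
Qed.

Lemma pull_comp (I J K : choiceType) (h : I -> option J) (k : J -> option K) :
  partial_inj h -> partial_inj k -> pull h \o pull k = pull (fun x => obind k (h x)).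
Proof.
move=> hi ki; apply/funext => f; apply: l2P_eq => x /=.
rewrite !pullE//; first by case: (h x) => //= y; rewrite pullE.
move=> {}x y z; case E : (h x) => [u|]//=; case F : (h y) => [v|]//= ku kv.
by apply: (hi _ _ u) => //; rewrite F (ki _ _ _ ku kv).
Qed.

Lemma pull_some (I : choiceType) : pull (fun x : I => Some x) = id.
Proof. by apply/funext => f; apply: l2P_eq => x; rewrite pullE// => a b c [->] [->]. Qed.

End Pull.

(** * Orthogonal mixing of paired basis vectors, and amplification *)

Section Mix.
Variables (R : realType) (I : choiceType) (phi : I -> I) (a b : I -> R).
Hypothesis phiK : involutive phi.
Hypothesis b_phi : forall x, b (phi x) = b x.
Hypothesis ab1 : forall x, a x ^+ 2 + b x ^+ 2 = 1.
Hypothesis ab0 : forall x, b x * (a x + a (phi x)) = 0.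

Let mixf (f : I -> R[i]) x := (a x)%:C * f x + (b x)%:C * f (phi x).
(** In the plane spanned by the basis vectors of [x] and [phi x] this is the
symmetric matrix with diagonal [a x], [a (phi x)] and off-diagonal entry [b
x]; the hypotheses of this section say that it is orthogonal. *)
Definition mix (f : l2 R I) : l2 R I := mkl2 (mixf f).

Let esum_phi (f : I -> \bar R) : \esum_(x in [set: I]) f (phi x) = \esum_(x in [set: I]) f x.
Proof.
rewrite (@reindex_esum R I I [set: I] [set: I] phi f)//; split=> //.
  by move=> x y _ _; exact: (inv_inj phiK).
by move=> x _; exists (phi x).
Qed.

Let csqr_mix f x : csqr (mixf f x) + csqr (mixf f (phi x)) = csqr (f x) + csqr (f (phi x)).
Proof.
rewrite /mixf phiK b_phi; have := ab1 x; have := ab1 (phi x); have := ab0 x.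
rewrite b_phi; move: (a x) (a (phi x)) (b x) (f x) (f (phi x)) => s t c [p q] [u v] h1 h2 h3.
rewrite /csqr /=.
transitivity ((p ^+ 2 + q ^+ 2) * (s ^+ 2 + c ^+ 2) + (u ^+ 2 + v ^+ 2) * (t ^+ 2 + c ^+ 2)
   + 2 * (c * (s + t)) * (p * u + q * v)); first by ring.
by rewrite h1 h2 h3 !mulr1 mulr0 mul0r addr0.
Qed.

(** Each index is counted once by itself and once through [phi]. *)
Let energy_mix f : (energy (mixf f) + energy (mixf f) = energy f + energy f)%E.
Proof.
have dbl (g : I -> R[i]) : (energy g + energy g =
    \esum_(x in [set: I]) (csqr (g x) + csqr (g (phi x)))%:E)%E.
  rewrite /energy -{2}(esum_phi (fun i => (csqr (g i))%:E)) -esumD => [||i _]; last 2 first.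
  - by move=> i _; rewrite lee_fin csqr_ge0.
  - by rewrite lee_fin csqr_ge0.
  by apply: eq_esum => x _; rewrite EFinD.
by rewrite !dbl; apply: eq_esum => x _; rewrite csqr_mix.
Qed.

Lemma mixE f x : mix f x = (a x)%:C * f x + (b x)%:C * f (phi x).
Proof.
rewrite mkl2E//; apply: (@le_lt_trans _ _ (energy (mixf f) + energy (mixf f))%E).
  by rewrite leeDl// energy_ge0.
by rewrite energy_mix energy_l2 -EFinD ltry.
Qed.

Lemma mix_linear : linear mix.
Proof.
move=> c f g; apply: l2P_eq => x; rewrite l2DE l2ZE !mixE !l2DE !l2ZE.
ring.
Qed.

Lemma nrm_mix f : nrm (mix f) = nrm f.
Proof.
have := energy_mix f; have -> : energy (mixf f) = energy (mix f).
  by congr energy; apply/funext => x; rewrite mixE.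
rewrite !energy_l2 -!EFinD => -[] /eqP; rewrite -!mulr2n eqrMn2r /=.
by rewrite eqrXn2 ?nrm_ge0// => /eqP.
Qed.

Lemma mix_bop : bounded_operator mix.
Proof.
apply/bopP; split; [exact: mix_linear|exists 1 => // f].
by rewrite nrm_mix mul1r.
Qed.

Lemma mixK f : mix (mix f) = f.
Proof.
apply: l2P_eq => x; rewrite !mixE phiK b_phi.
have -> : (a x)%:C * ((a x)%:C * f x + (b x)%:C * f (phi x)) +
   (b x)%:C * ((a (phi x))%:C * f (phi x) + (b x)%:C * f x) =
   (a x ^+ 2 + b x ^+ 2)%:C * f x + (b x * (a x + a (phi x)))%:C * f (phi x).
  rewrite !(rmorphD, rmorphM, rmorphXn) /=; ring.
by rewrite ab1 ab0 rmorph1 rmorph0 mul1r mul0r addr0.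
Qed.

Lemma mix_adjoint : adjoint mix mix.
Proof.
apply: adjoint_delta => [||y x]; [exact: mix_bop..|].
rewrite !mixE /= rmorphD !rmorphM /= !rmorph_nat.
have cR (r : R) : Num.conj (r%:C) = r%:C by apply/CrealP; rewrite -complexr0 complex_real.
rewrite !cR.
have e : (phi y == x) = (phi x == y) by apply/eqP/eqP => <-; rewrite phiK.
rewrite e; congr (_ + _); first by rewrite eq_sym; case: eqVneq => [->|]; rewrite ?mulr0.
by case: eqVneq => [<-|]; rewrite ?b_phi ?mulr0.
Qed.

End Mix.

Section Slices.
Variables (R : realType) (K J : choiceType).
Implicit Types (f : l2 R (K * J)%type) (S T : l2 R J -> l2 R J).

(** The component of a vector of the tensor product along the basis vector [m]
of the first factor. *)
Definition slice (m : K) : l2 R (K * J)%type -> l2 R J := pull (fun j => Some (m, j)).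

Let slice_inj (m : K) : partial_inj (fun j : J => Some (m, j)).
Proof. by move=> x y z [<-] [->]. Qed.

Lemma slice_linear m : linear (slice m).
Proof. exact: pull_linear (@slice_inj m). Qed.

Lemma sliceE m f j : slice m f j = f (m, j).
Proof. by rewrite pullE. Qed.

(** Summation over pairs in two steps. *)
Lemma energy_slice (f : K * J -> R[i]) :
  (energy f = \esum_(m in [set: K]) energy (fun j => f (m, j)))%E.
Proof.
rewrite /energy (@esum_esum _ _ _ [set: K] (fun=> [set: J]) (fun m j => (csqr (f (m, j)))%:E)).
  by congr esum; [apply/seteqP; split|apply/funext => -[]].
by move=> i j _ _; rewrite lee_fin csqr_ge0.
Qed.

Lemma slice_delta m x : slice m (l2_delta R x) = if m == x.1 then l2_delta R x.2 else 0.
Proof.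
apply: l2P_eq => j; rewrite sliceE /= -pair_eqE /= /pair_eq /=.
by case: eqVneq.
Qed.

(** The operator 1 (x) T, applied slice by slice. *)
Definition ampl (T : l2 R J -> l2 R J) f : l2 R (K * J)%type :=
  mkl2 (fun x => T (slice x.1 f) x.2).

Let energy_ampl T M f : 0 <= M -> bounded_by T M ->
  (energy (fun x => T (slice x.1 f) x.2) <= (M ^+ 2)%:E * energy f)%E.
Proof.
move=> M0 HM; rewrite !energy_slice -esumZ; last 2 first.
- exact: exprn_ge0.
- by move=> m; exact: energy_ge0.
apply: le_esum => m _ /=.
have -> : energy (fun j => f (m, j)) = energy (slice m f).
  by congr energy; apply/funext => j; rewrite sliceE.
rewrite !energy_l2 -EFinM lee_fin -exprMn ler_pXn2r ?nnegrE ?mulr_ge0 ?nrm_ge0//.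
Qed.

Lemma amplE T f x : bounded_operator T -> ampl T f x = T (slice x.1 f) x.2.
Proof.
move=> /bopP[_ [M M0 HM]]; rewrite mkl2E//.
apply: le_lt_trans (energy_ampl _ (ltW M0) HM) _.
by rewrite energy_l2 -EFinM ltry.
Qed.

Lemma slice_ampl T f m : bounded_operator T -> slice m (ampl T f) = T (slice m f).
Proof. by move=> bT; apply: l2P_eq => j; rewrite sliceE amplE. Qed.

Lemma ampl_linear T : bounded_operator T -> linear (ampl T).
Proof.
move=> bT a f g; apply: l2P_eq => x; rewrite l2DE l2ZE !amplE//.
have [lT _] := bT.
by rewrite slice_linear lT.
Qed.

Lemma ampl_bounded_by T M : 0 <= M -> bounded_operator T -> bounded_by T M -> bounded_by (ampl T) M.
Proof.
move=> M0 bT HM f; apply: nrm_le_energy => //; apply: le_trans _ (energy_ampl f M0 HM).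
by apply: le_esum => x _; rewrite amplE.
Qed.

Lemma ampl_bop T : bounded_operator T -> bounded_operator (ampl T).
Proof.
move=> bT; have /bopP[_ [M M0 HM]] := bT; apply/bopP; split; first exact: ampl_linear.
by exists M => //; apply: ampl_bounded_by => //; exact: ltW.
Qed.

Lemma ampl_comp S T : bounded_operator S -> bounded_operator T ->
  ampl (S \o T) = ampl S \o ampl T.
Proof.
move=> bS bT; apply/funext => f; apply: l2P_eq => x /=.
rewrite !amplE//=; last exact: bop_comp.
by rewrite slice_ampl.
Qed.

Lemma amplD S T : bounded_operator S -> bounded_operator T ->
  ampl (fun x => S x + T x) = (fun f => ampl S f + ampl T f).
Proof.
move=> bS bT; apply/funext => f; apply: l2P_eq => x.
by rewrite l2DE !amplE//; exact: bopD.
Qed.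

Lemma amplZ c T : bounded_operator T ->
  ampl (fun x => c *: T x) = (fun f => c *: ampl T f).
Proof.
move=> bT; apply/funext => f; apply: l2P_eq => x.
by rewrite l2ZE !amplE//; exact: bopZ.
Qed.

Lemma ampl_adjoint S T : bounded_operator S -> bounded_operator T ->
  adjoint S T -> adjoint (ampl S) (ampl T).
Proof.
move=> bS bT ST; have [lS _] := bS; have [lT _] := bT.
apply: adjoint_delta => [||x y]; [exact: ampl_bop..|].
rewrite !amplE// !slice_delta eq_sym; case: eqVneq => _.
  exact: adjoint_deltaE.
by rewrite (linop0 lS) (linop0 lT) rmorph0.
Qed.

Lemma ampl_pull h : partial_inj h ->
  ampl (pull h) = pull (fun x : K * J => omap (pair x.1) (h x.2)).
Proof.
move=> hi; apply/funext => f; apply: l2P_eq => x.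
rewrite amplE; last exact: pull_bop.
rewrite !pullE//; first by case: (h x.2) => //= j; rewrite sliceE.
move=> [m1 x1] [m2 x2] z /=; case E: (h x1) => [u|]//=; case F : (h x2) => [v|]//=.
by move=> <- [-> uv]; rewrite uv in F; rewrite (hi _ _ _ E F).
Qed.

(** A relabelling of the basis of the first factor permutes the slices and
erases some of them, and [ampl T] treats all slices alike. *)
Lemma ampl_commute T (h : K -> option K) : bounded_operator T -> partial_inj h ->
  let P := pull (fun x : K * J => omap (pair^~ x.2) (h x.1)) in
  ampl T \o P = P \o ampl T.
Proof.
move=> bT hi P; have [lT _] := bT.
have Pi : partial_inj (fun x : K * J => omap (pair^~ x.2) (h x.1)).
  move=> [m1 x1] [m2 x2] z /=; case E: (h m1) => [u|]//=; case F : (h m2) => [v|]//=.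
  by move=> <- [uv ->]; rewrite uv in F; rewrite (hi _ _ _ E F).
apply/funext => f; apply: l2P_eq => -[m j] /=; rewrite amplE//= [RHS]pullE//=.
have sE : slice m (P f) = if h m is Some k then slice k f else 0.
  apply: l2P_eq => i; rewrite sliceE [LHS]pullE//=.
  by case: (h m) => //= k; rewrite sliceE.
by rewrite sE; case: (h m) => [k|]/=; rewrite ?amplE// (linop0 lT).
Qed.

End Slices.

(** * Words as multiplicity functions *)

Section Words.
Implicit Types w : wam_word.

(** Sites are numbered from 0 and letters from 1, so site [i] carries the
letter [i.+1]. *)
Definition cnt (i : nat) w : nat := count_mem i.+1 (val w).

Lemma path_leq1E (s : seq nat) : path leq 1 s = all (leq 1) s && sorted leq s.
Proof. by rewrite path_sortedE//; exact: leq_trans. Qed.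

(** A sorted word is determined by its multiplicities. All identities between
words below are checked through this lemma. *)
Lemma word_ext w w' : (forall i, cnt i w = cnt i w') -> w = w'.
Proof.
move=> H; apply/val_inj; have := valP w; have := valP w'.
rewrite !path_leq1E => /andP[p' s'] /andP[p s].
apply: (sorted_eq leq_trans anti_leq s s').
apply/allP => -[|i] _ /=; last by apply/eqP; exact: (H i).
rewrite !(count_memPn _)//; apply/negP.
  by move=> /(allP p').
by move=> /(allP p).
Qed.

Fact setc_subproof (i n : nat) w :
  path leq 1%N (sort leq (nseq n i.+1 ++ [seq k <- val w | k != i.+1])).
Proof.
rewrite path_leq1E sort_sorted ?andbT; last exact: leq_total.
rewrite all_sort all_cat all_nseq orbT /=.
apply/allP => k; rewrite mem_filter => /andP[_].
by have := valP w; rewrite path_leq1E => /andP[/allP p _] /p.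
Qed.

Definition setc (i n : nat) w : wam_word := Sub _ (setc_subproof i n w).

Lemma cnt_setc i n w j : cnt j (setc i n w) = if j == i then n else cnt j w.
Proof.
rewrite /cnt /= (permP (permEl (perm_sort _ _))) count_cat count_nseq /= eqSS.
have [->|ji] := eqVneq j i.
  rewrite mul1n count_filter (@eq_count _ _ pred0) ?count_pred0 ?addn0// => k /=.
  by case: eqP.
rewrite mul0n add0n count_filter; apply: eq_count => k /=.
by case: eqP => // ->; rewrite eqSS ji.
Qed.

Definition low (i : nat) w : bool := all (fun j => cnt j w == 0%N) (iota 0 i).

Lemma lowP i w : reflect (forall j, (j < i)%N -> cnt j w = 0%N) (low i w).
Proof.
apply: (iffP allP) => H j; first by move=> ji; apply/eqP/H; rewrite mem_iota.
by rewrite mem_iota => /= ji; apply/eqP/H.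
Qed.

Lemma low_setc i j n w : (i <= j)%N -> low i (setc j n w) = low i w.
Proof.
move=> ij; apply: eq_in_all => k; rewrite mem_iota => /= ki.
have kj : (k < j)%N by exact: leq_trans ki ij.
by rewrite cnt_setc (ltn_eqF kj).
Qed.

Lemma lowS i w : low i.+1 w = low i w && (cnt i w == 0%N).
Proof. by rewrite /low -addn1 iotaD all_cat /= andbT. Qed.

Lemma low_all i w : low i w = all (leq i.+1) (val w).
Proof.
have := valP w; rewrite path_leq1E => /andP[/allP p _].
apply/lowP/allP => [H k kw|H j ji].
  rewrite leqNgt; apply/negP => ki; have := p _ kw; case: k kw ki => // k kw ki _.
  by have := H k ki; move/eqP; rewrite -leqn0 leqNgt -has_count has_pred1 kw.
apply/count_memPn/negP => /H; by rewrite ltnS leqNgt ji.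
Qed.

Lemma setc_cnt i w : setc i (cnt i w) w = w.
Proof. by apply: word_ext => j; rewrite cnt_setc; case: eqP => // ->. Qed.

Lemma setcK i m n w : setc i m (setc i n w) = setc i m w.
Proof. by apply: word_ext => j; rewrite !cnt_setc; case: eqP. Qed.

Lemma setcC i j m n w : i != j -> setc i m (setc j n w) = setc j n (setc i m w).
Proof.
move=> ij; apply: word_ext => k; rewrite !cnt_setc.
by case: (eqVneq k i) => // ->; rewrite (negbTE ij).
Qed.

(** Prepending the letter of site [i] keeps the word sorted exactly when no
earlier site is occupied; it is then an increment of a multiplicity. *)
Lemma insub_consE i w : insub (i.+1 :: val w) =
  if low i w then Some (setc i (cnt i w).+1 w) else None.
Proof.
have pE : path leq 1%N (i.+1 :: val w) = low i w.
  rewrite low_all /= path_sortedE; last exact: leq_trans.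
  by have := valP w; rewrite path_leq1E => /andP[_ ->]; rewrite andbT.
case: insubP => [v iw vE|]; rewrite -pE; last by move/negbTE ->.
rewrite iw; congr Some; apply: word_ext => j; rewrite cnt_setc {1}/cnt vE /= eqSS eq_sym.
by case: eqP => // ->; rewrite add1n.
Qed.

(** The creators, their adjoints and the matrix units of one site are all of
this form, so that their commutation relations reduce to those of [setc]. *)
Definition upd (c : pred wam_word) (i : nat) (v : nat -> nat) w : option wam_word :=
  if c w then Some (setc i (v (cnt i w)) w) else None.

Lemma upd_partial_inv (c c' : pred wam_word) i v v' :
  (forall w, c w -> c' (setc i (v (cnt i w)) w) /\ v' (v (cnt i w)) = cnt i w) ->
  (forall w, c' w -> c (setc i (v' (cnt i w)) w) /\ v (v' (cnt i w)) = cnt i w) ->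
  partial_inv (upd c i v) (upd c' i v').
Proof.
have main (d d' : pred wam_word) u u' :
    (forall w, d w -> d' (setc i (u (cnt i w)) w) /\ u' (u (cnt i w)) = cnt i w) ->
    forall x y, upd d i u x = Some y -> upd d' i u' y = Some x.
  move=> H x y; rewrite /upd; case: ifP => // dx [<-].
  have [-> E] := H _ dx; congr Some.
  by rewrite cnt_setc eqxx E setcK setc_cnt.
by move=> H H' x y; split; apply: main.
Qed.

(** [pull (create i)] is the creator of the letter [i.+1], and [pull (annih
i)] its adjoint: since [pull] reverses direction, [create i] removes a letter.
*)
Definition create i := upd (fun w => low i w && (0 < cnt i w)%N) i predn.
Definition annih i := upd (low i) i succn.
(** At site [n], [pull] turns [vac], [raise] and [lower] into the matrix units
e_00, e_10 and e_01. *)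
Definition vac n := upd (fun w => cnt n w == 0%N) n id.
Definition raise n := upd (fun w => cnt n w == 1%N) n (fun=> 0%N).
Definition lower n := upd (fun w => cnt n w == 0%N) n (fun=> 1%N).

Lemma create_annih i : partial_inv (create i) (annih i).
Proof.
apply: upd_partial_inv => w; last by move=> wi; rewrite low_setc// cnt_setc eqxx wi.
by move=> /andP[wi c0]; rewrite low_setc// wi prednK.
Qed.

Lemma vac_vac n : partial_inv (vac n) (vac n).
Proof. by apply: upd_partial_inv => w; rewrite cnt_setc eqxx. Qed.

Lemma raise_lower n : partial_inv (raise n) (lower n).
Proof. by apply: upd_partial_inv => w /eqP ->; rewrite cnt_setc eqxx. Qed.

Lemma create_inj i : partial_inj (create i).
Proof. exact: partial_inv_inj (create_annih i). Qed.

Lemma annih_inj i : partial_inj (annih i).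
Proof. exact: partial_inv_inj (partial_invC (create_annih i)). Qed.

Lemma vac_inj n : partial_inj (vac n).
Proof. exact: partial_inv_inj (vac_vac n). Qed.

Lemma raise_inj n : partial_inj (raise n).
Proof. exact: partial_inv_inj (raise_lower n). Qed.

Lemma lower_inj n : partial_inj (lower n).
Proof. exact: partial_inv_inj (partial_invC (raise_lower n)). Qed.

Definition lowp n (w : wam_word) := if low n w then Some w else None.

Lemma lowp_inv n : partial_inv (lowp n) (lowp n).
Proof. by move=> x y; rewrite /lowp; split; case: ifP => // l [<-]; rewrite l. Qed.

End Words.

Arguments cnt : simpl never.
Arguments setc : simpl never.

(** * Rotating a site into the entangled basis *)

Section SiteRotation.
Variable R : realType.
Local Notation I := (wam_word * wam_word)%type.
Implicit Types (x : I) (j n : nat).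

Definition label j x : nat * nat := (cnt j x.1, cnt j x.2).

Definition setl j n x : I := (setc j n x.1, setc j n x.2).

Definition flip j x : I :=
  if label j x == (0, 0)%N then setl j 1 x
  else if label j x == (1, 1)%N then setl j 0 x else x.

Lemma label_setl i j n x : label i (setl j n x) = if i == j then (n, n) else label i x.
Proof. by rewrite /label /= !cnt_setc; case: ifP. Qed.

Lemma setlK j n m x : setl j m (setl j n x) = setl j m x.
Proof. by rewrite /setl /= !setcK. Qed.

Lemma setl_label j n x : label j x = (n, n) -> setl j n x = x.
Proof. by case: x => m w [/= h1 h2]; rewrite /setl /= -{1}h1 -h2 !setc_cnt. Qed.

Lemma flipK j : involutive (flip j).
Proof.
move=> x; rewrite {2}/flip; case: eqP => [e|n0].
  by rewrite /flip label_setl eqxx /= setlK setl_label.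
case: eqP => [e|n1]; first by rewrite /flip label_setl eqxx /= setlK setl_label.
by rewrite /flip; do 2 case: eqP => //.
Qed.

Lemma label_flip i j x : i != j -> label i (flip j x) = label i x.
Proof.
move=> /negbTE ij.
rewrite /flip; case: (label j x == (0, 0)%N); first by rewrite label_setl ij.
by case: (label j x == (1, 1)%N); rewrite // label_setl ij.
Qed.

Definition isqrt2 : R := (Num.sqrt 2)^-1.

Lemma isqrt2_gt0 : 0 < isqrt2. Proof. by rewrite invr_gt0 sqrtr_gt0. Qed.

Lemma isqrt2_sqr : isqrt2 ^+ 2 = 2^-1.
Proof. by rewrite exprVn sqr_sqrtr. Qed.

Definition rot_diag j x : R :=
  if label j x == (0, 0)%N then isqrt2 else if label j x == (1, 1)%N then - isqrt2 else 1.
Definition rot_off j x : R :=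
  if label j x == (0, 0)%N then isqrt2 else if label j x == (1, 1)%N then isqrt2 else 0.

(** The Hadamard rotation in the plane of the labels (0, 0) and (1, 1) of site
[j], the identity on the other labels. It sends the basis vector of the label
(0, 0) to the entangled vector (e_0 (x) e_0 + e_1 (x) e_1) / sqrt 2. *)
Definition site_rot j : l2 R I -> l2 R I := mix (flip j) (rot_diag j) (rot_off j).

Let rot_off_flip j x : rot_off j (flip j x) = rot_off j x.
Proof.
rewrite /rot_off /flip; case e0: (label j x == (0, 0)%N).
  by rewrite label_setl eqxx.
by case e1: (label j x == (1, 1)%N); rewrite ?label_setl ?eqxx// e0 e1.
Qed.

Let rot_norm1 j x : rot_diag j x ^+ 2 + rot_off j x ^+ 2 = 1.
Proof.
rewrite /rot_diag /rot_off; have h : isqrt2 ^+ 2 + isqrt2 ^+ 2 = 1.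
  by rewrite isqrt2_sqr [RHS]splitr !mul1r.
case: eqP => // _; case: eqP => _; first by rewrite sqrrN.
by rewrite expr1n expr0n /= addr0.
Qed.

Let rot_orth j x : rot_off j x * (rot_diag j x + rot_diag j (flip j x)) = 0.
Proof.
rewrite /rot_diag /rot_off /flip; case e0: (label j x == (0, 0)%N).
  by rewrite label_setl eqxx /= subrr mulr0.
case e1: (label j x == (1, 1)%N); last by rewrite mul0r.
by rewrite label_setl eqxx /= addNr mulr0.
Qed.

Lemma site_rotE j f x : site_rot j f x = (rot_diag j x)%:C * f x + (rot_off j x)%:C * f (flip j x).
Proof.
by apply: mixE; first [exact: flipK|exact: rot_off_flip|exact: rot_norm1|exact: rot_orth].
Qed.

Lemma site_rot_bop j : bounded_operator (site_rot j).
Proof.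
by apply: mix_bop; first [exact: flipK|exact: rot_off_flip|exact: rot_norm1|exact: rot_orth].
Qed.

Lemma nrm_site_rot j f : nrm (site_rot j f) = nrm f.
Proof.
by apply: nrm_mix; first [exact: flipK|exact: rot_off_flip|exact: rot_norm1|exact: rot_orth].
Qed.

Lemma site_rotK j : involutive (site_rot j).
Proof.
by apply: mixK; first [exact: flipK|exact: rot_off_flip|exact: rot_norm1|exact: rot_orth].
Qed.

Lemma site_rot_adjoint j : adjoint (site_rot j) (site_rot j).
Proof.
by apply: mix_adjoint; first [exact: flipK|exact: rot_off_flip|exact: rot_norm1|exact: rot_orth].
Qed.

(** The rotation at site [j] is built from the label at [j] and its flip, so
it commutes with every relabelling that respects both. *)
Lemma site_rot_pull j (h : I -> option I) : partial_inj h ->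
  (forall x, h (flip j x) = omap (flip j) (h x)) ->
  (forall x y, h x = Some y -> label j y = label j x) ->
  site_rot j \o pull h = pull (R := R) h \o site_rot j.
Proof.
move=> hi hf hl; apply/funext => f; apply: l2P_eq => x /=.
rewrite site_rotE !pullE// hf; case E : (h x) => [y|] /=; last by rewrite !mulr0 addr0.
by rewrite site_rotE /rot_diag /rot_off (hl _ _ E).
Qed.

Definition on1 (h : wam_word -> option wam_word) x : option I := omap (pair^~ x.2) (h x.1).
Definition on2 (h : wam_word -> option wam_word) x : option I := omap (pair x.1) (h x.2).

Lemma on2_partial_inv h k : partial_inv h k -> partial_inv (on2 h) (on2 k).
Proof.
have main h' k' : partial_inv h' k' -> forall x y, on2 h' x = Some y -> on2 k' y = Some x.
  move=> hk [m w] y; rewrite /on2 /=; case E : (h' w) => [m'|] //= [<-] /=.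
  by move/hk: E => ->.
by move=> hk x y; split; apply: main => //; exact: partial_invC.
Qed.

Lemma on1_partial_inj h : partial_inj h -> partial_inj (on1 h).
Proof.
move=> hi [m1 x1] [m2 x2] z; rewrite /on1 /=.
case E: (h m1) => [u|]//=; case F : (h m2) => [v|]//=.
by move=> <- [uv ->]; rewrite uv in F; rewrite (hi _ _ _ E F).
Qed.

Lemma on2_partial_inj h : partial_inj h -> partial_inj (on2 h).
Proof.
move=> hi [m1 x1] [m2 x2] z; rewrite /on2 /=.
case E: (h x1) => [u|]//=; case F : (h x2) => [v|]//=.
by move=> <- [-> uv]; rewrite uv in F; rewrite (hi _ _ _ E F).
Qed.

Lemma upd_setc (c : pred wam_word) i v j n w : i != j -> (forall m w', c (setc j m w') = c w') ->
  upd c i v (setc j n w) = omap (setc j n) (upd c i v w).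
Proof.
move=> ij cj; rewrite /upd cj; case: ifP => //= _.
by rewrite cnt_setc (negbTE ij) setcC.
Qed.

Lemma cnt_upd c i v j w w' : i != j -> upd c i v w = Some w' -> cnt j w' = cnt j w.
Proof.
by move=> ij; rewrite /upd; case: ifP => // _ [<-]; rewrite cnt_setc eq_sym (negbTE ij).
Qed.

Lemma site_rot_on2_upd (c : pred wam_word) i v j : i != j -> (forall m w', c (setc j m w') = c w') ->
  partial_inj (upd c i v) ->
  site_rot j \o pull (on2 (upd c i v)) = pull (R := R) (on2 (upd c i v)) \o site_rot j.
Proof.
move=> ij cj hi; have lab x y : on2 (upd c i v) x = Some y -> label j y = label j x.
  rewrite /on2; case E : (upd _ _ _ _) => [w|] //= [<-] /=.
  by rewrite /label /= (cnt_upd ij E).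
apply: site_rot_pull => //; first exact: on2_partial_inj.
move=> [m w]; rewrite /on2 /= [flip j (m, w)]/flip.
have L w' : upd c i v w = Some w' -> label j (m, w') = label j (m, w).
  by move=> E; rewrite /label /= (cnt_upd ij E).
case e0: (label j (m, w) == (0, 0)%N); last case e1: (label j (m, w) == (1, 1)%N).
- rewrite /= upd_setc//; case E : (upd _ _ _ _) => [w'|] //=.
  by rewrite /flip L// e0.
- rewrite /= upd_setc//; case E : (upd _ _ _ _) => [w'|] //=.
  by rewrite /flip L// e0 e1.
- case E : (upd _ _ _ _) => [w'|] //=; by rewrite /flip L// e0 e1.
Qed.

Lemma site_rot_on1_upd (c : pred wam_word) i v j : i != j -> (forall m w', c (setc j m w') = c w') ->
  partial_inj (upd c i v) ->
  site_rot j \o pull (on1 (upd c i v)) = pull (R := R) (on1 (upd c i v)) \o site_rot j.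
Proof.
move=> ij cj hi; have lab x y : on1 (upd c i v) x = Some y -> label j y = label j x.
  rewrite /on1; case E : (upd _ _ _ _) => [w|] //= [<-] /=.
  by rewrite /label /= (cnt_upd ij E).
apply: site_rot_pull => //; first exact: on1_partial_inj.
move=> [m w]; rewrite /on1 /= [flip j (m, w)]/flip.
have L w' : upd c i v m = Some w' -> label j (w', w) = label j (m, w).
  by move=> E; rewrite /label /= (cnt_upd ij E).
case e0: (label j (m, w) == (0, 0)%N); last case e1: (label j (m, w) == (1, 1)%N).
- rewrite /= upd_setc//; case E : (upd _ _ _ _) => [w'|] //=.
  by rewrite /flip L// e0.
- rewrite /= upd_setc//; case E : (upd _ _ _ _) => [w'|] //=.
  by rewrite /flip L// e0 e1.
- case E : (upd _ _ _ _) => [w'|] //=; by rewrite /flip L// e0 e1.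
Qed.

End SiteRotation.

(** * The representation as a limit of rotated amplifications *)

Section LocalRepresentation.
Variable R : realType.
Local Notation I := (wam_word * wam_word)%type.
Local Notation H := (l2 R (wam_word * wam_word)%type).
Local Notation F := (wam_fock R).
Implicit Types (O P : H -> H) (S T : F -> F) (f h : H).

Fixpoint rots k : H -> H := if k is k'.+1 then rots k' \o site_rot k' else id.
Fixpoint rots_inv k : H -> H := if k is k'.+1 then site_rot k' \o rots_inv k' else id.

Lemma rots_bop k : bounded_operator (rots k).
Proof. by elim: k => [|k IH]; [exact: bop_id|have := bop_comp IH (@site_rot_bop R k)]. Qed.

Lemma rots_inv_bop k : bounded_operator (rots_inv k).
Proof. by elim: k => [|k IH]; [exact: bop_id|have := bop_comp (@site_rot_bop R k) IH]. Qed.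

Lemma nrm_rots k f : nrm (rots k f) = nrm f.
Proof. by elim: k f => //= k IH f; rewrite IH nrm_site_rot. Qed.

Lemma nrm_rots_inv k f : nrm (rots_inv k f) = nrm f.
Proof. by elim: k f => //= k IH f; rewrite nrm_site_rot IH. Qed.

Lemma rotsK k : cancel (rots k) (rots_inv k).
Proof. by elim: k => // k IH f /=; rewrite IH site_rotK. Qed.

Lemma rots_invK k : cancel (rots_inv k) (rots k).
Proof. by elim: k => // k IH f /=; rewrite site_rotK IH. Qed.

Lemma rots_adjoint k : adjoint (rots k) (rots_inv k).
Proof. by elim: k => //= k IH; exact: adjoint_comp IH (site_rot_adjoint k). Qed.

Definition conj_rots k O : H -> H := rots k \o O \o rots_inv k.

Lemma conj_rots_comp k O P : conj_rots k (O \o P) = conj_rots k O \o conj_rots k P.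
Proof. by apply/funext => f; rewrite /conj_rots /= rotsK. Qed.

Lemma conj_rots_id k : conj_rots k id = id.
Proof. by apply/funext => f; rewrite /conj_rots /= rots_invK. Qed.

Lemma conj_rots_bop k O : bounded_operator O -> bounded_operator (conj_rots k O).
Proof. by move=> bO; apply: bop_comp (rots_inv_bop k); apply: bop_comp bO; exact: rots_bop. Qed.

Lemma conj_rots_bounded_by k O M : bounded_by O M -> bounded_by (conj_rots k O) M.
Proof. by move=> HM f; rewrite /conj_rots /= nrm_rots -(nrm_rots_inv k f). Qed.

Lemma conj_rots_adjoint k O P : adjoint O P -> adjoint (conj_rots k O) (conj_rots k P).
Proof.
by move=> OP x y; rewrite /conj_rots /= rots_adjoint OP (adjointC (@rots_adjoint k)).
Qed.

(** An operator that involves only the sites before [N] commutes with the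
later rotations. *)
Definition stable N O := forall j, (N <= j)%N -> site_rot j \o O = O \o site_rot j.

Lemma stable_comp N O P : stable N O -> stable N P -> stable N (O \o P).
Proof.
by move=> sO sP j Nj; rewrite compA (sO _ Nj) -compA (sP _ Nj) compA.
Qed.

Lemma conj_rots_stable N k O : stable N O -> (N <= k)%N -> conj_rots k O = conj_rots N O.
Proof.
move=> sO; elim: k => [|k IH]; first by rewrite leqn0 => /eqP ->.
rewrite leq_eqVlt => /predU1P[->//|Nk]; rewrite -(IH Nk).
apply/funext => f; rewrite /conj_rots /=; congr (rots k _).
have := congr1 (fun g => g (site_rot k (rots_inv k f))) (sO k Nk) => /= ->.
by rewrite site_rotK.
Qed.

(** The operator T acts on the second leg, in coordinates where the reference
vector of each of the first [k] sites is the entangled vector. *)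
Definition alpha k T := conj_rots k (ampl (K := wam_word) T).

Lemma alpha_bop k T : bounded_operator T -> bounded_operator (alpha k T).
Proof. by move=> bT; exact/conj_rots_bop/ampl_bop. Qed.

Lemma alpha_bounded_by k T M : 0 <= M -> bounded_operator T -> bounded_by T M -> bounded_by (alpha k T) M.
Proof. by move=> M0 bT HM; apply: conj_rots_bounded_by; exact: ampl_bounded_by. Qed.

Lemma alphaD k S T h : bounded_operator S -> bounded_operator T ->
  alpha k (fun x => S x + T x) h = alpha k S h + alpha k T h.
Proof.
move=> bS bT; have [lU _] := rots_bop k.
by rewrite /alpha /conj_rots /= (amplD wam_word bS bT) (linopD _ _ lU).
Qed.

Lemma alphaZ k c T h : bounded_operator T -> alpha k (fun x => c *: T x) h = c *: alpha k T h.
Proof.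
move=> bT; have [lU _] := rots_bop k.
by rewrite /alpha /conj_rots /= (amplZ wam_word c bT) (linopZ _ _ lU).
Qed.

Lemma alphaB k S T h : bounded_operator S -> bounded_operator T ->
  alpha k (fun x => S x - T x) h = alpha k S h - alpha k T h.
Proof.
move=> bS bT; have -> : (fun x => S x - T x) = (fun x => S x + (-1) *: T x).
  by apply/funext => x; rewrite scaleN1r.
have bNT := bopZ (-1) bT.
by rewrite (alphaD k h bS bNT) (alphaZ k _ h bT) scaleN1r.
Qed.

Lemma alpha_comp k S T : bounded_operator S -> bounded_operator T ->
  alpha k (S \o T) = alpha k S \o alpha k T.
Proof. by move=> bS bT; rewrite /alpha ampl_comp// conj_rots_comp. Qed.

(** Convergence in operator norm: the set of convergent operators is then
closed, hence a C*-algebra as soon as it is a *-algebra. *)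
Definition is_limit T (O : H -> H) := [/\ bounded_operator T, bounded_operator O &
  forall e : R, 0 < e -> exists N, forall k, (N <= k)%N ->
     bounded_by (fun h => alpha k T h - O h) e].

Lemma is_limit_tends T O h : is_limit T O -> tends (fun k => alpha k T h) (O h).
Proof.
move=> [_ _ H] e e0; have [|N HN] := H (e / (nrm h + 1)).
  by rewrite divr_gt0// ltr_wpDl ?nrm_ge0.
exists N => k Nk; apply: le_trans (HN k Nk h) _.
rewrite -mulrA -[leRHS]mulr1 ler_pM2l// mulrC ler_pdivrMr ?mul1r ?lerDl//.
by rewrite ltr_wpDl ?nrm_ge0.
Qed.

Lemma is_limit_uniq T O P : is_limit T O -> is_limit T P -> O = P.
Proof.
move=> TO TP; apply/funext => h.
exact: tends_uniq (is_limit_tends h TO) (is_limit_tends h TP).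
Qed.

Lemma stable_is_limit N T : bounded_operator T -> stable N (ampl T) ->
  is_limit T (alpha N T).
Proof.
move=> bT sT; split=> //; first exact: alpha_bop.
move=> e e0; exists N => k Nk h; rewrite /alpha (conj_rots_stable sT Nk) subrr nrm0.
by rewrite mulr_ge0 ?nrm_ge0// ltW.
Qed.

Lemma is_limitD S T O P : is_limit S O -> is_limit T P ->
  is_limit (fun x => S x + T x) (fun h => O h + P h).
Proof.
move=> [bS bO HS] [bT bP HT]; split; [exact: bopD..|] => e e0.
have e2 : 0 < e / 2 by rewrite divr_gt0.
have [N HN] := HS _ e2; have [M HM] := HT _ e2.
exists (maxn N M) => k; rewrite geq_max => /andP[Nk Mk] h.
rewrite alphaD// opprD addrACA; apply: le_trans (nrmD _ _) _.
rewrite (half_mul e); exact: lerD (HN k Nk h) (HM k Mk h).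
Qed.

Lemma is_limitZ c T O : is_limit T O -> is_limit (fun x => c *: T x) (fun h => c *: O h).
Proof.
move=> [bT bO HT]; split; [exact: bopZ..|] => e e0.
have c0 := Re_norm_ge0 c.
have [|N HN] := HT (e / (complex.Re `|c| + 1)); first by rewrite divr_gt0// ltr_wpDl.
exists N => k Nk h; rewrite alphaZ// -scalerBr nrmZ.
apply: le_trans (ler_wpM2l c0 (HN k Nk h)) _; rewrite mulrA ler_wpM2r ?nrm_ge0//.
by rewrite mulrCA -[leRHS]mulr1 ler_pM2l// ler_pdivrMr ?mul1r ?lerDl// ltr_wpDl.
Qed.

Lemma is_limitM S T O P : is_limit S O -> is_limit T P -> is_limit (S \o T) (O \o P).
Proof.
move=> [bS bO HS] [bT bP HT]; split; [exact: bop_comp..|] => e e0.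
have /bopP[lS [M M0 HM]] := bS; have /bopP[lP [L L0 HL]] := bP.
have [|N1 H1] := HS (e / 2 / L); first by rewrite !divr_gt0.
have [|N2 H2] := HT (e / 2 / M); first by rewrite !divr_gt0.
exists (maxn N1 N2) => k; rewrite geq_max => /andP[n1 n2] h.
rewrite alpha_comp//=; have [la _] := alpha_bop k bS.
apply: le_trans (nrm_trans (alpha k S (P h)) _ _) _; rewrite -(linopB _ _ la).
rewrite (half_mul e); apply: lerD.
  apply: le_trans (alpha_bounded_by k (ltW M0) bS HM _) _.
  apply: le_trans (ler_wpM2l (ltW M0) (H2 k n2 h)) _.
  by rewrite mulrA [M * _]mulrC divfK// gt_eqF.
apply: le_trans (H1 k n1 _) _.
apply: le_trans (ler_wpM2l _ (HL h)) _; first by rewrite !divr_ge0 ?ltW.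
by rewrite mulrA divfK// gt_eqF.
Qed.

Lemma cauchy_is_limit T : bounded_operator T ->
  (forall e : R, 0 < e -> exists N, forall k l, (N <= k)%N -> (N <= l)%N ->
     bounded_by (fun h => alpha k T h - alpha l T h) e) ->
  exists O, is_limit T O.
Proof.
move=> bT HT; have /bopP[lT [M M0 HM]] := bT.
have [h|O HO] := @choice H H (fun h o => tends (fun k => alpha k T h) o).
  apply: nrm_cauchy => e e0.
  have [|N HN] := HT (e / (nrm h + 1)).
    by rewrite divr_gt0// ltr_wpDl ?nrm_ge0.
  exists N => k l Nk Nl; apply: le_trans (HN k l Nk Nl h) _.
  rewrite -mulrA -[leRHS]mulr1 ler_pM2l// mulrC ler_pdivrMr ?mul1r ?lerDl//.
  by rewrite ltr_wpDl ?nrm_ge0.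
exists O; split=> //.
  apply/bopP; split=> [a x y|].
    apply: tends_uniq (HO _) _.
    have -> : (fun k => alpha k T (a *: x + y)) = (fun k => a *: alpha k T x + alpha k T y).
      by apply/funext => k; have [la _] := alpha_bop k bT; rewrite la.
    by apply: tendsD; [apply: tendsZ|].
  exists M => // h; apply: tends_bound (HO h) _ => k.
  exact: alpha_bounded_by (ltW M0) bT HM h.
move=> e e0; have [N HN] := HT e e0; exists N => k Nk h.
apply/ler_addgt0Pr => d d0; have [L HL] := HO h d d0.
apply: le_trans (nrm_trans (alpha (maxn N L) T h) _ _) _.
exact: lerD (HN _ _ Nk (leq_maxl _ _) h) (HL _ (leq_maxr _ _)).
Qed.

(** The norms of an operator and of its adjoint agree, so the adjoints of a
Cauchy sequence form a Cauchy sequence. *)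
Lemma is_limit_adjoint_ex S T O : is_limit S O -> adjoint S T -> exists P, is_limit T P.
Proof.
move=> [bS bO HS] ST; have bT := adjoint_bop bS ST.
apply: cauchy_is_limit => // e e0; have e2 : 0 < e / 2 by rewrite divr_gt0.
have [N HN] := HS _ e2; exists N => k l Nk Nl.
have adj k' : adjoint (alpha k' S) (alpha k' T) by apply: conj_rots_adjoint; exact: ampl_adjoint.
apply: adjoint_bounded_by (adjointB (adj k) (adj l)); first exact: ltW.
move=> h; apply: le_trans (nrm_trans (O h) _ _) _.
rewrite (half_mul e) [nrm (O h - _)]nrmBC; exact: lerD (HN k Nk h) (HN l Nl h).
Qed.

Lemma is_limit_adjoint S T O P : is_limit S O -> is_limit T P -> adjoint S T -> adjoint O P.
Proof.
move=> SO TP ST; have [bS bO _] := SO; have [bT bP _] := TP.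
have adj k : adjoint (alpha k S) (alpha k T) by apply: conj_rots_adjoint; exact: ampl_adjoint.
move=> x y; apply/eqP; rewrite -subr_eq0; apply/eqP/Re_norm_le0_eq0.
apply/ler_addgt0Pl => e e0; rewrite addr0.
pose K := nrm x + nrm y + 1; have K0 : 0 < K by rewrite ltr_wpDl// addr_ge0 ?nrm_ge0.
have eK : 0 < e / K by rewrite divr_gt0.
have [N HN] := is_limit_tends x SO eK; have [M HM] := is_limit_tends y TP eK.
pose k := maxn N M.
have -> : inner (O x) y - inner x (P y) =
   inner x (alpha k T y - P y) - inner (alpha k S x - O x) y.
  by rewrite innerBl innerBr adj; ring.
apply: le_trans (Re_normD _ _) _; rewrite normrN.
apply: le_trans (lerD (inner_le _ _) (inner_le _ _)) _.
have h1 := HN k (leq_maxl _ _); have h2 := HM k (leq_maxr _ _).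
apply: le_trans (lerD (ler_wpM2l (nrm_ge0 x) h2) (ler_wpM2r (nrm_ge0 y) h1)) _.
rewrite [nrm x * _]mulrC -mulrDr mulrAC ler_pdivrMr// ler_pM2l//.
by rewrite lerDl.
Qed.

Lemma is_limit_closed T : bounded_operator T ->
  (forall e : R, 0 < e -> exists2 S, (exists O, is_limit S O) & bounded_by (fun x => T x - S x) e) ->
  exists O, is_limit T O.
Proof.
move=> bT HT; apply: cauchy_is_limit => // e e0.
have e4 : 0 < e / 4 by rewrite divr_gt0.
have [S [O [bS bO HS]] TS] := HT _ e4; have [N HN] := HS _ e4.
exists N => k l Nk Nl h.
have bTS : bounded_operator (fun x => T x - S x).
  have -> : (fun x => T x - S x) = (fun x => T x + (-1) *: S x).
    by apply/funext => x; rewrite scaleN1r.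
  by apply: bopD => //; exact: bopZ.
have h1 k' : nrm (alpha k' T h - alpha k' S h) <= e / 4 * nrm h.
  by rewrite -alphaB//; apply: alpha_bounded_by => //; exact: ltW.
have a1 := h1 k; have a2 := h1 l; have a3 := HN k Nk h; have a4 := HN l Nl h.
rewrite nrmBC in a2; rewrite nrmBC in a4.
have -> : e * nrm h = e / 4 * nrm h + (e / 4 * nrm h + (e / 4 * nrm h + e / 4 * nrm h)).
  by field.
apply: le_trans (nrm_trans (alpha k S h) _ _) _; apply: lerD a1 _.
apply: le_trans (nrm_trans (O h) _ _) _; apply: lerD a3 _.
apply: le_trans (nrm_trans (alpha l S h) _ _) _; exact: lerD a4 a2.
Qed.

Lemma creatorE i T : is_creator i.+1 T -> T = pull (create i).
Proof.
move=> [bT HT]; have ca := create_annih i.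
apply: bop_eq => //; first exact/pull_bop/partial_inv_inj/ca.
by move=> w; rewrite HT (pull_delta R w ca) insub_consE /annih /upd; case: ifP.
Qed.

Lemma create_is_creator i : is_creator (R := R) i.+1 (pull (create i)).
Proof.
have ca := create_annih i; split; first exact/pull_bop/partial_inv_inj/ca.
by move=> w; rewrite (pull_delta R w ca) insub_consE /annih /upd; case: ifP.
Qed.

Lemma ampl_upd c i v : partial_inj (upd c i v) ->
  ampl (K := wam_word) (pull (upd c i v)) = pull (R := R) (on2 (upd c i v)).
Proof. by move=> hi; rewrite ampl_pull. Qed.

Lemma stable_upd N (c : pred wam_word) i v : (i < N)%N ->
  (forall j n w, (N <= j)%N -> c (setc j n w) = c w) -> partial_inj (upd c i v) ->
  stable N (ampl (K := wam_word) (pull (R := R) (upd c i v))).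
Proof.
move=> iN cN hi j Nj; rewrite ampl_upd//; apply: site_rot_on2_upd => //.
  by rewrite ltn_eqF// (leq_trans iN).
by move=> n w; exact: cN.
Qed.

Lemma stable_create i : stable i.+1 (ampl (K := wam_word) (pull (R := R) (create i))).
Proof.
apply: stable_upd => //; last exact: partial_inv_inj (create_annih i).
by move=> j n w ij; rewrite low_setc ?(ltnW ij)// cnt_setc ltn_eqF.
Qed.

Lemma stable_annih i : stable i.+1 (ampl (K := wam_word) (pull (R := R) (annih i))).
Proof.
apply: stable_upd => //; last exact: partial_inv_inj (partial_invC (create_annih i)).
by move=> j n w ij; rewrite low_setc// ltnW.
Qed.

Definition convergent : set (F -> F) := [set T | exists O, is_limit T O].

Lemma is_limit_pull (h : wam_word -> option wam_word) N : partial_inj h ->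
  stable N (ampl (K := wam_word) (pull (R := R) h)) ->
  is_limit (pull h) (alpha N (pull h)).
Proof. by move=> hi sh; apply: stable_is_limit => //; exact: pull_bop. Qed.

Lemma is_limit_create i : is_limit (pull (create i)) (alpha i.+1 (pull (create i))).
Proof.
exact: is_limit_pull (partial_inv_inj (create_annih i)) (@stable_create i).
Qed.

Lemma is_limit_annih i : is_limit (pull (annih i)) (alpha i.+1 (pull (annih i))).
Proof.
exact: is_limit_pull (partial_inv_inj (partial_invC (create_annih i))) (@stable_annih i).
Qed.

Lemma generatorP T : wam_generators R T ->
  exists i, T = pull (create i) \/ T = pull (annih i).
Proof.
move=> [[//|i] _ [cT|[S cS ST]]]; exists i; first by left; exact: creatorE.
right; apply: adjoint_uniq ST _; rewrite (creatorE cS).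
exact: pull_adjoint (create_annih i).
Qed.

(** The convergent operators form a C*-algebra that contains the generators.
*)
Lemma wam_convergent : wam_algebra R `<=` convergent.
Proof.
move=> T; apply; split; last first.
  move=> {}T /generatorP[i [->|->]].
    by exists (alpha i.+1 (pull (create i))); exact: is_limit_create.
  by exists (alpha i.+1 (pull (annih i))); exact: is_limit_annih.
split.
- by move=> {}T [O []].
(* The zero operator is a multiple of a creator. *)
- have -> : (fun=> 0) = (fun x : F => 0 *: pull (create 0) x).
    by apply/funext => x; rewrite scale0r.
  by eexists; exact: is_limitZ (is_limit_create 0).
- move=> S {}T [O SO] [P TP]; exists (fun h => O h + P h); exact: is_limitD.
- move=> c {}T [O TO]; exists (fun h => c *: O h); exact: is_limitZ.
- move=> S {}T [O SO] [P TP]; exists (O \o P); exact: is_limitM.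
- move=> S {}T [O SO] ST; exact: is_limit_adjoint_ex SO ST.
- move=> {}T bT HT; apply: is_limit_closed => // e e0.
  have [S AS HS] := HT e e0; exists S => // x.
  by rewrite -lecR rmorphM /= -!nrmE.
Qed.

End LocalRepresentation.

Arguments rots : simpl never.
Arguments rots_inv : simpl never.

Section Representation.
Variable R : realType.
Local Notation I := (wam_word * wam_word)%type.
Local Notation H := (l2 R (wam_word * wam_word)%type).
Local Notation F := (wam_fock R).
Local Notation W := (wam_algebra R).
Local Notation ampl := (ampl (K := wam_word)).
Implicit Types (O P : H -> H) (S T : F -> F) (f g h : H).

Definition wam_rep T : H -> H :=
  match pselect (exists O, is_limit T O) with
  | left e => projT1 (cid e)
  | right _ => fun=> 0
  end.

Lemma wam_rep_limit T : W T -> is_limit T (wam_rep T).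
Proof.
move=> /wam_convergent WT; rewrite /wam_rep; case: pselect => // e.
exact: projT2 (cid e).
Qed.

Lemma wam_repE T O : W T -> is_limit T O -> wam_rep T = O.
Proof. by move=> WT; exact: is_limit_uniq (wam_rep_limit WT). Qed.

Lemma wam_D S T : W S -> W T -> W (fun x => S x + T x).
Proof. by move=> WS WT A [cA GA]; apply: (cstar_D cA); [exact: WS|exact: WT]. Qed.

Lemma wam_Z c T : W T -> W (fun x => c *: T x).
Proof. by move=> WT A [cA GA]; apply: (cstar_Z cA); exact: WT. Qed.

Lemma wam_M S T : W S -> W T -> W (S \o T).
Proof. by move=> WS WT A [cA GA]; apply: (cstar_M cA); [exact: WS|exact: WT]. Qed.

Lemma wam_create i : W (pull (create i)).
Proof.
by move=> A [cA GA]; apply: GA; exists i.+1 => //; left; exact: create_is_creator.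
Qed.

Lemma wam_annih i : W (pull (annih i)).
Proof.
move=> A [cA GA]; apply: GA; exists i.+1 => //; right.
exists (pull (create i)); first exact: create_is_creator.
exact: pull_adjoint (create_annih i).
Qed.

(** The vacuum projection of the sites before [n] is A_n composed with its
adjoint, so it belongs to the algebra. *)
Lemma lowpE n : pull (R := R) (lowp n) = pull (annih n) \o pull (create n).
Proof.
rewrite pull_comp; [|exact: annih_inj|exact: create_inj].
congr pull; apply/funext => w; rewrite /lowp /annih /upd; case: ifP => //= l.
by rewrite /create /upd low_setc// l cnt_setc eqxx /= setcK setc_cnt.
Qed.

Lemma wam_lowp n : W (pull (lowp n)).
Proof. by rewrite lowpE; apply: wam_M; [exact: wam_annih|exact: wam_create]. Qed.

Lemma wam_id : W id.
Proof. by have := wam_lowp 0; rewrite pull_some. Qed.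

Lemma wam_bop T : W T -> bounded_operator T.
Proof. by move=> /wam_rep_limit[]. Qed.

Lemma ampl_id : ampl (id : F -> F) = id.
Proof.
apply/funext => f; apply: l2P_eq => -[m w]; rewrite amplE; last exact: bop_id.
by rewrite sliceE.
Qed.

Lemma wam_rep_id : wam_rep id = id.
Proof.
apply: wam_repE wam_id _; split; [exact: bop_id..|] => e e0; exists 0%N => k _ h.
by rewrite /alpha ampl_id conj_rots_id subrr nrm0 mulr_ge0 ?nrm_ge0// ltW.
Qed.

(** Norm limits preserve all operations. Nondegeneracy holds because the
algebra contains the identity. *)
Lemma wam_rep_nondegenerate : nondegenerate_rep W wam_rep.
Proof.
split.
- by move=> S /wam_rep_limit[].
- move=> S T WS WT; apply: wam_repE; first exact: wam_D.
  by apply: is_limitD; exact: wam_rep_limit.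
- move=> c T WT; apply: wam_repE; first exact: wam_Z.
  by apply: is_limitZ; exact: wam_rep_limit.
- move=> S T WS WT; apply: wam_repE; first exact: wam_M.
  by apply: is_limitM; exact: wam_rep_limit.
- move=> S T WS WT; apply: is_limit_adjoint; exact: wam_rep_limit.
- by move=> y H0; have := H0 _ wam_id; rewrite wam_rep_id.
Qed.

Lemma stableW N K O : (N <= K)%N -> stable N O -> stable K O.
Proof. by move=> NK sO j Kj; apply: sO; exact: leq_trans Kj. Qed.

Lemma wam_rep_stable N T : W T -> stable N (ampl T) -> wam_rep T = alpha N T.
Proof. by move=> WT sT; apply: wam_repE => //; apply: stable_is_limit => //; exact: wam_bop. Qed.

Lemma create_delta i m (w w' : wam_word) : val w' = i.+1 :: val w ->
  ampl (pull (create i)) (l2_delta R (m, w)) = l2_delta R (m, w').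
Proof.
move=> ww'; rewrite ampl_pull; last exact: create_inj.
have -> : (fun x : I => omap (pair x.1) (create i x.2)) = on2 (create i) by [].
rewrite (pull_delta _ _ (on2_partial_inv (create_annih i))) /on2 /=.
suff -> : annih i w = Some w' by [].
by have := insub_consE i w; rewrite -ww' valK /annih /upd => <-.
Qed.

Lemma lowp_delta n m (w : wam_word) : low n w ->
  ampl (pull (lowp n)) (l2_delta R (m, w)) = l2_delta R (m, w).
Proof.
move=> lw; rewrite ampl_pull; last exact: partial_inv_inj (lowp_inv n).
have -> : (fun x : I => omap (pair x.1) (lowp n x.2)) = on2 (lowp n) by [].
by rewrite (pull_delta _ _ (on2_partial_inv (lowp_inv n))) /on2 /= /lowp lw.
Qed.

(** The first letter of a word is the smallest. *)
Lemma not_low_cons n (w : wam_word) : ~~ low n w ->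
  exists i (w' : wam_word), (i < n)%N /\ val w = i.+1 :: val w'.
Proof.
rewrite low_all; have := valP w; rewrite path_leq1E.
case E : (val w) => [|[|i] v]//= /andP[pv sv] nl.
have pv1 : path leq 1%N v by rewrite path_leq1E pv (path_sorted sv).
exists i, (Sub v pv1); split=> //; rewrite ltnNge; apply: contra nl => ni.
rewrite ltnS ni /=; move: sv; rewrite path_sortedE; last exact: leq_trans.
by case/andP=> /allP iv _; apply/allP => k /iv; apply: leq_ltn_trans.
Qed.

Lemma stable_lowp n : stable n.+1 (ampl (pull (R := R) (lowp n))).
Proof.
rewrite lowpE ampl_comp; [|exact: (pull_bop R (@annih_inj n))|exact: (pull_bop R (@create_inj n))].
by apply: stable_comp; [exact: stable_annih|exact: stable_create].
Qed.

(** An operator T of the single site n need not belong to the algebra, but T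
composed with the vacuum projection of the earlier sites does. An element of
the commutant thus commutes with T on the words without letter before site n.
The other words are obtained from these by creators of earlier sites, which
commute both with T and with the commutant; this is an induction on the length
of the word. *)
Lemma bicommutant_tail n T :
  bounded_operator T -> stable n.+1 (ampl T) ->
  (forall i, (i < n)%N -> T \o pull (create i) = pull (create i) \o T) ->
  W (T \o pull (lowp n)) -> stable n.+2 (ampl (T \o pull (lowp n))) ->
  commutant (commutant (wam_rep @` W)) (alpha n.+1 T).
Proof.
move=> bT sT Tc WTl sTl; split; first exact: alpha_bop.
move=> C [bC CW]; pose K := n.+2; pose C' := rots_inv K \o C \o rots K.
(* Conjugation by the rotations turns the representation into a plain
   amplification, with which C' commutes. *)
have bC' : bounded_operator C'.
  by apply: bop_comp (rots_bop _ K); apply: bop_comp bC; exact: rots_inv_bop.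
have comm S f : W S -> stable K (ampl S) -> C' (ampl S f) = ampl S (C' f).
  move=> WS sS; have /CW : (wam_rep @` W) (wam_rep S) by exists S.
  rewrite (wam_rep_stable WS sS) => /(congr1 (fun q => rots_inv K (q (rots K f)))).
  by rewrite /alpha /conj_rots /= !rotsK => ->.
suff key f : C' (ampl T f) = ampl T (C' f).
  rewrite /alpha -(conj_rots_stable sT (leqnSn n.+1)); apply/funext => f.
  have := key (rots_inv K f); rewrite /C' /= rots_invK => /(congr1 (rots K)); rewrite rots_invK => E.
  by rewrite /conj_rots /= E.
suff /(congr1 (fun q => q f)) : C' \o ampl T = ampl T \o C' by [].
have bA := ampl_bop wam_word bT.
apply: bop_eq; [exact: bop_comp bC' bA|exact: bop_comp bA bC'|move=> [m w] /=].
have [N] := ubnP (size (val w)); elim: N w => // N IH w wN.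
have [lw|/not_low_cons[i [w' [ni ww']]]] := boolP (low n w).
  have bP := pull_bop R (partial_inv_inj (lowp_inv n)).
  have sP : stable K (ampl (pull (R := R) (lowp n))) by exact: stableW (@stable_lowp n).
  rewrite -(lowp_delta m lw) (comm _ (l2_delta R (m, w)) (@wam_lowp n) sP).
  by have := comm _ (l2_delta R (m, w)) WTl sTl; rewrite ampl_comp.
have bc := pull_bop R (@create_inj i).
have sc : stable K (ampl (pull (R := R) (create i))).
  by apply: (stableW _ (@stable_create R i)); rewrite ltnS ltnW// ltnS ltnW.
have Tc' f' : ampl T (ampl (pull (create i)) f') = ampl (pull (create i)) (ampl T f').
  by have := congr1 (fun q => ampl q f') (Tc i ni); rewrite (ampl_comp _ bT bc) (ampl_comp _ bc bT).
have Wc := wam_create i.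
have wN' : (size (val w') < N)%N by move: wN; rewrite ww'.
rewrite -(create_delta m ww'); move: (l2_delta R (m, w')) (IH w' wN') => d' IHd.
apply: etrans (congr1 C' (Tc' d')) _; apply: etrans (comm _ (ampl T d') Wc sc) _.
apply: etrans (congr1 (ampl (pull (create i))) IHd) _.
apply: etrans (esym (Tc' (C' d'))) _.
exact: (congr1 (ampl T) (esym (comm _ d' Wc sc))).
Qed.

End Representation.

(** * Tail operators and their mirrors *)

Section Asymptotics.
Variable R : realType.
Local Notation I := (wam_word * wam_word)%type.
Local Notation H := (l2 R (wam_word * wam_word)%type).
Local Notation F := (wam_fock R).
Local Notation W := (wam_algebra R).
Local Notation ampl := (ampl (K := wam_word)).
Local Notation rep := (@wam_rep R).
Implicit Types (O P : H -> H) (S T : F -> F) (f g h : H).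

(** Before the limit, the operator on the first leg and the amplified operator
on the second leg are conjugated by the same unitary, so they commute. *)
Lemma commutant_on1 N (k : wam_word -> option wam_word) :
  partial_inj k -> stable N (pull (R := R) (on1 k)) ->
  commutant (rep @` W) (conj_rots N (pull (on1 k))).
Proof.
move=> ki sk; have bX : bounded_operator (conj_rots N (pull (R := R) (on1 k))).
  exact/conj_rots_bop/pull_bop/on1_partial_inj.
split=> // _ [T WT <-]; apply/funext => h /=.
have LT := wam_rep_limit WT.
have h1 := is_limit_tends (conj_rots N (pull (on1 k)) h) LT.
have h2 := tends_lin bX (is_limit_tends h LT).
suff h3 : tends (fun j => conj_rots N (pull (on1 k)) (alpha j T h)) (rep T (conj_rots N (pull (on1 k)) h)).
  exact: tends_uniq h3 h2.
apply: (tends_ev (N := N)) h1 => j Nj; rewrite -(conj_rots_stable sk Nj).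
have e1 := congr1 (fun q => q h) (conj_rots_comp j (ampl T) (pull (on1 k))).
have e2 := congr1 (fun q => q h) (conj_rots_comp j (pull (on1 k)) (ampl T)).
apply: etrans (esym e1) _; apply: etrans e2.
congr (conj_rots j _ h); exact: ampl_commute (wam_bop WT) ki.
Qed.

Definition vaclab n (x : I) : option I := if label n x == (0, 0)%N then Some x else None.

Lemma vaclab_inv n : partial_inv (vaclab n) (vaclab n).
Proof. by move=> x y; rewrite /vaclab; split; case: ifP => // l [<-]; rewrite l. Qed.

Lemma vaclab_inj n : partial_inj (vaclab n).
Proof. exact: partial_inv_inj (vaclab_inv n). Qed.

(** A basis vector with label (0, 0) at site [n] stands for a vector that is
entangled at this site: each operator is represented after conjugation by the
rotations. *)
Definition vacproj n : H -> H := pull (vaclab n).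

Lemma vacprojE n f x : vacproj n f x = if label n x == (0, 0)%N then f x else 0.
Proof. by rewrite pullE; [rewrite /vaclab; case: ifP|exact: vaclab_inj]. Qed.

Lemma site_rot_vacproj j n : j != n -> site_rot j \o vacproj n = vacproj n \o site_rot j.
Proof.
move=> jn; apply: site_rot_pull; first exact: vaclab_inj.
  move=> x; rewrite /vaclab label_flip; last by rewrite eq_sym.
  by case: ifP.
by move=> x y; rewrite /vaclab; case: ifP => // _ [<-].
Qed.

(** The first [k] rotations do not see the label at site [n]. *)
Lemma rots_inv_vacproj k n f : (k <= n)%N -> rots_inv k (vacproj n f) = vacproj n (rots_inv k f).
Proof.
elim: k => // k IH kn; rewrite [LHS]/(site_rot k (rots_inv k _)) [rots_inv k.+1 f]/(site_rot k (rots_inv k f)).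
rewrite IH; last exact: ltnW.
by have := congr1 (fun q => q (rots_inv k f)) (@site_rot_vacproj k n (negbT (ltn_eqF kn))).
Qed.

Lemma vacproj_bounded_by n : bounded_by (vacproj n) 1.
Proof. exact: pull_bounded_by (@vaclab_inj n). Qed.

Lemma vacproj_linear n : linear (vacproj n).
Proof. exact: pull_linear (@vaclab_inj n). Qed.

Lemma cnt_eventually0 (w : wam_word) : exists N, forall n, (N <= n)%N -> cnt n w = 0%N.
Proof.
have [N HN] : exists N, forall k, k \in val w -> (k <= N)%N.
  elim: (val w) => [|a s [N HN]]; first by exists 0%N.
  exists (maxn a N) => k; rewrite inE => /predU1P[->|/HN kN]; first exact: leq_maxl.
  by rewrite (leq_trans kN) ?leq_maxr.
exists N => n Nn; apply/count_memPn/negP => /HN.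
by rewrite ltnNge Nn.
Qed.

(** A word has finitely many letters, so each basis vector is eventually
fixed. *)
Lemma vacproj_strong h e : 0 < e ->
  exists N, forall n, (N <= n)%N -> nrm (h - vacproj n h) <= e.
Proof.
move=> e0; apply: (@strong_delta R _ H (fun n h => h - vacproj n h) 2) => //.
- by move=> n a x y; rewrite vacproj_linear scalerBr opprD addrACA.
- by move=> n x; apply: le_trans (nrmB _ _) _; rewrite mulr_natl mulr2n lerD2l -[leRHS]mul1r; exact: vacproj_bounded_by.
- move=> [m w]; have [N HN] := cnt_eventually0 m; have [L HL] := cnt_eventually0 w.
  exists (maxn N L) => n; rewrite geq_max => /andP[Nn Ln].
  rewrite /vacproj (pull_delta _ _ (@vaclab_inv n)) /vaclab /label /= HN// HL//.
  by rewrite subrr.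
Qed.

(** The entangled vector at site [n]: equal amplitudes on the labels (0, 0)
and (1, 1), none elsewhere. *)
Lemma site_rot_vacprojE n g x : site_rot n (vacproj n g) x =
  if label n x == (0, 0)%N then (isqrt2 R)%:C * g x
  else if label n x == (1, 1)%N then (isqrt2 R)%:C * g (setl n 0 x) else 0.
Proof.
rewrite site_rotE !vacprojE /rot_diag /rot_off /flip.
case e0 : (label n x == (0, 0)%N); first by rewrite label_setl eqxx /= mulr0 addr0.
case e1 : (label n x == (1, 1)%N); first by rewrite label_setl eqxx /= mulr0 add0r.
by rewrite mulr0 mul0r addr0.
Qed.

(** Acting on either leg, e_00 sends the entangled vector to e_0 (x) e_0 /
sqrt 2. *)
Lemma vac_mirrored n g :
  pull (on2 (vac n)) (site_rot n (vacproj n g)) = pull (on1 (vac n)) (site_rot n (vacproj n g)).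
Proof.
apply: l2P_eq => -[m w]; rewrite !pullE; [|exact/on1_partial_inj/vac_inj|exact/on2_partial_inj/vac_inj].
rewrite /on1 /on2 /vac /upd /= !setc_cnt.
case cm : (cnt n m == 0%N); case cw : (cnt n w == 0%N) => //=.
  by rewrite site_rot_vacprojE /label /= !xpair_eqE cw (eqP cm).
by rewrite site_rot_vacprojE /label /= !xpair_eqE cm (eqP cw) andbF.
Qed.

(** Both e_10 on the second leg and e_01 on the first send the entangled
vector to e_0 (x) e_1 / sqrt 2. *)
Lemma raise_mirrored n g :
  pull (on2 (raise n)) (site_rot n (vacproj n g)) = pull (on1 (lower n)) (site_rot n (vacproj n g)).
Proof.
apply: l2P_eq => -[m w]; rewrite !pullE; [|exact/on1_partial_inj/lower_inj|exact/on2_partial_inj/raise_inj].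
rewrite /on1 /on2 /lower /raise /upd /=.
case cm : (cnt n m == 0%N); case cw : (cnt n w == 1%N) => //=.
- rewrite !site_rot_vacprojE /label /= !cnt_setc !eqxx (eqP cm) (eqP cw) /= /setl /= setcK.
  by have := setc_cnt n m; rewrite (eqP cm) => ->.
- rewrite site_rot_vacprojE /label /= !cnt_setc !eqxx !xpair_eqE.
  by rewrite cw.
- rewrite site_rot_vacprojE /label /= !cnt_setc !eqxx !xpair_eqE.
  by rewrite cm andbF.
Qed.

Lemma mirror_conj_rots n O P f :
  (forall g, O (site_rot n (vacproj n g)) = P (site_rot n (vacproj n g))) ->
  conj_rots n.+1 O (vacproj n f) = conj_rots n.+1 P (vacproj n f).
Proof.
move=> OP; rewrite /conj_rots /= -[rots_inv n.+1 _]/(site_rot n (rots_inv n (vacproj n f))).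
by rewrite rots_inv_vacproj// OP.
Qed.

(** [X n] and [X' n] agree on vectors fixed by [vacproj n], so their
difference tends strongly to zero; and [p] commutes with [X' n]. *)
Lemma asymptotically_central (X X' : nat -> H -> H) (p : H -> H) :
  (forall n, linear (X n)) -> (forall n, linear (X' n)) ->
  (forall n, bounded_by (X n) 1) -> (forall n, bounded_by (X' n) 1) ->
  (forall n f, X n (vacproj n f) = X' n (vacproj n f)) ->
  bounded_operator p -> (forall n, p \o X' n = X' n \o p) ->
  forall h e, 0 < e -> exists N, forall n, (N <= n)%N -> nrm (p (X n h) - X n (p h)) <= e.
Proof.
move=> lX lX' bX bX' XX' bp pX' h e e0; have /bopP[lp [M M0 HM]] := bp.
have D n f : nrm (X n f - X' n f) <= 2 * nrm (f - vacproj n f).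
  have -> : X n f - X' n f = X n (f - vacproj n f) - X' n (f - vacproj n f).
    by rewrite (linopB _ _ (lX n)) (linopB _ _ (lX' n)) XX' opprB addrA subrK.
  apply: le_trans (nrmB _ _) _; apply: le_trans (lerD (bX n _) (bX' n _)) _.
  by rewrite -mulrDl.
have e1 : 0 < e / 2 / 2 by rewrite !divr_gt0.
have [|N1 H1] := @vacproj_strong h (e / 2 / 2 / M); first by rewrite divr_gt0.
have [N2 H2] := @vacproj_strong (p h) _ e1.
exists (maxn N1 N2) => n; rewrite geq_max => /andP[n1 n2].
have -> : p (X n h) - X n (p h) = p (X n h - X' n h) - (X n (p h) - X' n (p h)).
  rewrite (linopB _ _ lp); have := congr1 (fun q => q h) (pX' n) => /= ->.
  by rewrite opprB addrA subrK.
apply: le_trans (nrmB _ _) _.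
have h1 := le_trans (D n h) (ler_wpM2l (ler0n R 2) (H1 n n1)).
have h2 := le_trans (D n (p h)) (ler_wpM2l (ler0n R 2) (H2 n n2)).
have h3 := le_trans (HM _) (ler_wpM2l (ltW M0) h1).
apply: le_trans (lerD h3 h2) _.
have -> : M * (2 * (e / 2 / 2 / M)) = e / 2 by field; rewrite gt_eqF.
have -> : 2 * (e / 2 / 2) = e / 2 by field.
by rewrite -splitr.
Qed.

(** Lowering the raised second leg and then projecting on the label (0, 0)
recovers the amplitude 1 / sqrt 2 of that label, and both of these steps are
contractions. *)
Lemma tail_raise_lower_bound n f :
  isqrt2 R * nrm (vacproj n f) <= nrm (alpha n.+1 (pull (raise n)) (vacproj n f)).
Proof.
rewrite /alpha /conj_rots /= nrm_rots ampl_pull; last exact: raise_inj.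
rewrite -[fun x => omap _ _]/(on2 (raise n)) -[rots_inv n.+1 _]/(site_rot n (rots_inv n (vacproj n f))).
rewrite -(nrm_rots_inv n (vacproj n f)) rots_inv_vacproj//; set g := rots_inv n f.
set r := site_rot n _.
have E : vacproj n (pull (on2 (lower n)) (pull (on2 (raise n)) r)) = (isqrt2 R)%:C *: vacproj n g.
  apply: l2P_eq => x; apply: etrans (vacprojE _ _ _) _.
  rewrite -[RHS]/((isqrt2 R)%:C * vacproj n g x) (vacprojE n g).
  case lx : (label n x == (0, 0)%N); last by rewrite mulr0.
  case: x lx => m w; rewrite /label /= xpair_eqE => /andP[/eqP cm /eqP cw].
  rewrite pullE; last exact/on2_partial_inj/lower_inj.
  rewrite /on2 /lower /upd /= cw eqxx /= pullE; last exact/on2_partial_inj/raise_inj.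
  rewrite /on2 /raise /upd /= cnt_setc eqxx /= setcK.
  have -> : setc n 0 w = w by have := setc_cnt n w; rewrite cw.
  by rewrite site_rot_vacprojE /label /= cm cw.
have <- : nrm ((isqrt2 R)%:C *: vacproj n g) = isqrt2 R * nrm (vacproj n g).
  rewrite nrmZ; congr (_ * _).
  by rewrite ger0_norm// ler0c ltW// isqrt2_gt0.
rewrite -E; apply: le_trans (vacproj_bounded_by _ _) _; rewrite mul1r.
have := pull_bounded_by (on2_partial_inj (@lower_inj n)) (pull (on2 (raise n)) r).
by rewrite mul1r.
Qed.

End Asymptotics.

(** * Absence of abelian projections *)

(** Up to errors of size [B * e], p X p Z p z is X Z z = 0 and p Z p X p z is
p Z z; being abelian makes the two equal. The remaining [e] accounts for the
distance between p Z z and Z z. *)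
Lemma abelian_almost_kills (R : realType) (V : hilbertType R) (p X Z : V -> V)
    (B e : R) (z : V) :
  linear p -> linear X -> linear Z -> 0 < B -> bounded_by p B -> bounded_by X 1 -> bounded_by Z 1 ->
  p \o p = p ->
  (p \o X \o p) \o (p \o Z \o p) = (p \o Z \o p) \o (p \o X \o p) ->
  (forall x, X (Z x) = 0) -> (forall x, Z (X x) = Z x) -> p z = z ->
  nrm (p (X z) - X z) <= e -> nrm (p (Z z) - Z z) <= e ->
  nrm (Z z) <= (2 * B + 1) * e.
Proof.
move=> lp lX lZ B0 bp bX bZ pp ab XZ ZX pz a1 a2.
have ppE x : p (p x) = p x by exact: (congr1 (fun q => q x) pp).
have comm : p (X (p (Z z))) = p (Z (p (X z))).
  by have := congr1 (fun q => q z) ab; rewrite /= pz !ppE.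
have b1 : nrm (p (X (p (Z z)))) <= B * e.
  rewrite -(subr0 (X (p (Z z)))) -(XZ z) -(linopB _ _ lX).
  apply: le_trans (bp _) (ler_wpM2l (ltW B0) _).
  by apply: le_trans (bX _) _; rewrite mul1r.
have b2 : nrm (p (Z (p (X z))) - p (Z z)) <= B * e.
  rewrite -(ZX z) -(linopB _ _ lp) -(linopB _ _ lZ).
  apply: le_trans (bp _) (ler_wpM2l (ltW B0) _).
  by apply: le_trans (bZ _) _; rewrite mul1r.
rewrite comm in b1.
have b3 := nrmB (p (Z (p (X z)))) (p (Z (p (X z))) - p (Z z)); rewrite subKr in b3.
have b4 := nrmB (p (Z z)) (p (Z z) - Z z); rewrite subKr in b4.
apply: le_trans b4 _; rewrite mulrDl mul1r; apply: lerD a2.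
apply: le_trans b3 _; rewrite -mulrA mulr_natl mulr2n; exact: lerD.
Qed.

Section NotTypeI.
Variable R : realType.
Local Notation I := (wam_word * wam_word)%type.
Local Notation H := (l2 R (wam_word * wam_word)%type).
Local Notation F := (wam_fock R).
Local Notation W := (wam_algebra R).
Local Notation ampl := (ampl (K := wam_word)).
Local Notation rep := (@wam_rep R).
Local Notation M := (commutant (commutant (rep @` W))).
Implicit Types (O P : H -> H) (S T : F -> F) (f g h : H).

(** The matrix units e_00 and e_10 of the second leg at site [n], in rotated
coordinates. *)
Definition tail_vac n : H -> H := alpha n.+1 (pull (vac n)).
Definition tail_raise n : H -> H := alpha n.+1 (pull (raise n)).
(** The matrix units e_00 and e_01 of the first leg at site [n], in rotated
coordinates. *)
Definition mirror_vacuum n : H -> H := conj_rots n.+1 (pull (on1 (vac n))).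
Definition mirror_lower n : H -> H := conj_rots n.+1 (pull (on1 (lower n))).

Lemma stable_cnt n (d : pred nat) v : partial_inj (upd (fun w => d (cnt n w)) n v) ->
  stable n.+1 (ampl (pull (R := R) (upd (fun w => d (cnt n w)) n v))).
Proof.
move=> hi; apply: stable_upd => // j m w nj.
by rewrite cnt_setc ltn_eqF.
Qed.

Lemma stable_on1_cnt n (d : pred nat) v : partial_inj (upd (fun w => d (cnt n w)) n v) ->
  stable n.+1 (pull (R := R) (on1 (upd (fun w => d (cnt n w)) n v))).
Proof.
move=> hi j nj; apply: site_rot_on1_upd => //; first by rewrite ltn_eqF.
by move=> m w; rewrite cnt_setc ltn_eqF.
Qed.

(** The creator of an earlier site does not involve site [n]. *)
Lemma upd_create n i (d : pred nat) v : (i < n)%N ->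
  partial_inj (upd (fun w => d (cnt n w)) n v) ->
  pull (R := R) (upd (fun w => d (cnt n w)) n v) \o pull (create i) =
  pull (create i) \o pull (upd (fun w => d (cnt n w)) n v).
Proof.
move=> ni hi; rewrite !pull_comp//; [|exact: create_inj..].
congr pull; apply/funext => w; rewrite /create /upd.
have ne : (i == n) = false by rewrite ltn_eqF.
case dn : (d (cnt n w)); case l : (low i w && (0 < cnt i w)%N) => //=.
- by rewrite low_setc ?(ltnW ni)// !cnt_setc ne l eq_sym ne dn setcC ?ne.
- by rewrite low_setc ?(ltnW ni)// cnt_setc ne l.
- by rewrite cnt_setc eq_sym ne dn.
Qed.

Lemma vac_lowp n : pull (R := R) (vac n) \o pull (lowp n) = pull (lowp n.+1).
Proof.
rewrite pull_comp; [|exact: vac_inj|exact: partial_inv_inj (lowp_inv n)].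
congr pull; apply/funext => w; rewrite /vac /upd /lowp lowS setc_cnt.
by case: ifP => _ /=; rewrite ?andbT ?andbF.
Qed.

(** On words without letter before site [n], raising the multiplicity from 0
to 1 is a creation preceded by the projection on words without letter at site
[n]. *)
Lemma raise_lowp n :
  pull (R := R) (raise n) \o pull (lowp n) = pull (create n) \o pull (lowp n.+1).
Proof.
rewrite pull_comp; [|exact: raise_inj|exact: partial_inv_inj (lowp_inv n)].
rewrite pull_comp; [|exact: create_inj|exact: partial_inv_inj (lowp_inv n.+1)].
congr pull; apply/funext => w; rewrite /raise /create /upd /lowp.
case l : (low n w); case c : (cnt n w) => [|[|k]] //=.
- by rewrite lowS !low_setc// l cnt_setc eqxx.
- by rewrite lowS low_setc// l cnt_setc eqxx.
- by rewrite low_setc// l.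
Qed.

Lemma tail_vac_in n : M (tail_vac n).
Proof.
apply: bicommutant_tail.
- exact/pull_bop/vac_inj.
- exact: (@stable_cnt n (fun c => c == 0%N) id (@vac_inj n)).
- by move=> i ni; exact: (@upd_create n i (fun c => c == 0%N) id ni (@vac_inj n)).
- by rewrite vac_lowp; exact: wam_lowp.
- by rewrite vac_lowp; exact: stable_lowp.
Qed.

Lemma tail_raise_in n : M (tail_raise n).
Proof.
have b1 := pull_bop R (@create_inj n).
have b2 := pull_bop R (partial_inv_inj (lowp_inv n.+1)).
apply: bicommutant_tail.
- exact/pull_bop/raise_inj.
- exact: (@stable_cnt n (fun c => c == 1%N) (fun=> 0%N) (@raise_inj n)).
- by move=> i ni; exact: (@upd_create n i (fun c => c == 1%N) (fun=> 0%N) ni (@raise_inj n)).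
- by rewrite raise_lowp; apply: wam_M; [exact: wam_create|exact: wam_lowp].
- rewrite raise_lowp (ampl_comp _ b1 b2); apply: stable_comp; last exact: stable_lowp.
  exact: stableW (@stable_create R n).
Qed.

Lemma tail_vac_bounded_by n : bounded_by (tail_vac n) 1.
Proof. by apply: alpha_bounded_by => //; [exact/pull_bop/vac_inj|exact/pull_bounded_by/vac_inj]. Qed.

Lemma tail_raise_bounded_by n : bounded_by (tail_raise n) 1.
Proof. by apply: alpha_bounded_by => //; [exact/pull_bop/raise_inj|exact/pull_bounded_by/raise_inj]. Qed.

Lemma tail_vac_linear n : linear (tail_vac n).
Proof. by have [] := alpha_bop n.+1 (pull_bop R (@vac_inj n)). Qed.

Lemma tail_raise_linear n : linear (tail_raise n).
Proof. by have [] := alpha_bop n.+1 (pull_bop R (@raise_inj n)). Qed.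

Lemma vac_raise n f : tail_vac n (tail_raise n f) = 0.
Proof.
have bv := pull_bop R (@vac_inj n); have br := pull_bop R (@raise_inj n).
rewrite -[LHS]/((alpha n.+1 (pull (vac n)) \o alpha n.+1 (pull (raise n))) f).
rewrite -(alpha_comp n.+1 bv br) /alpha pull_comp; [|exact: vac_inj|exact: raise_inj].
have -> : (fun x => obind (raise n) (vac n x)) = (fun=> None).
  apply/funext => w; rewrite /vac /raise /upd; case: eqP => //= c.
  by rewrite setc_cnt c.
have -> : pull (R := R) (fun _ : wam_word => @None wam_word) = (fun=> 0).
  by apply/funext => g; apply: l2P_eq => x; rewrite pullE.
have [lU _] := rots_bop R n.+1.
rewrite /conj_rots /=; have -> : ampl (fun=> 0 : F) (rots_inv n.+1 f) = 0; last exact: linop0.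
by apply: l2P_eq => x; rewrite amplE//; exact: bop0.
Qed.

Lemma raise_vac n f : tail_raise n (tail_vac n f) = tail_raise n f.
Proof.
have bv := pull_bop R (@vac_inj n); have br := pull_bop R (@raise_inj n).
rewrite -[LHS]/((alpha n.+1 (pull (raise n)) \o alpha n.+1 (pull (vac n))) f).
rewrite -(alpha_comp n.+1 br bv) pull_comp; [|exact: raise_inj|exact: vac_inj].
rewrite /tail_raise; have -> // : (fun x => obind (vac n) (raise n x)) = raise n.
apply/funext => w; rewrite /vac /raise /upd; case: eqP => //= c.
by rewrite cnt_setc eqxx /= setcK.
Qed.

Section Central.
Variables (p : H -> H).
Hypothesis Mp : M p.

Let bp : bounded_operator p. Proof. by case: Mp. Qed.

Lemma tail_vac_central h e : 0 < e ->
  exists N, forall n, (N <= n)%N -> nrm (p (tail_vac n h) - tail_vac n (p h)) <= e.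
Proof.
have b n : bounded_operator (mirror_vacuum n) by exact/conj_rots_bop/pull_bop/on1_partial_inj/vac_inj.
apply: (@asymptotically_central R tail_vac mirror_vacuum) => //.
- exact: tail_vac_linear.
- by move=> n; case: (b n).
- exact: tail_vac_bounded_by.
- by move=> n; apply: conj_rots_bounded_by; exact/pull_bounded_by/on1_partial_inj/vac_inj.
- move=> n f; apply: mirror_conj_rots => g; rewrite ampl_pull; last exact: vac_inj.
  exact: vac_mirrored.
- move=> n; have [_ cp] := Mp; apply/esym/cp; apply: commutant_on1; first exact: vac_inj.
  exact: (@stable_on1_cnt n (fun c => c == 0%N) id (@vac_inj n)).
Qed.

Lemma tail_raise_central h e : 0 < e ->
  exists N, forall n, (N <= n)%N -> nrm (p (tail_raise n h) - tail_raise n (p h)) <= e.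
Proof.
have b n : bounded_operator (mirror_lower n) by exact/conj_rots_bop/pull_bop/on1_partial_inj/lower_inj.
apply: (@asymptotically_central R tail_raise mirror_lower) => //.
- exact: tail_raise_linear.
- by move=> n; case: (b n).
- exact: tail_raise_bounded_by.
- by move=> n; apply: conj_rots_bounded_by; exact/pull_bounded_by/on1_partial_inj/lower_inj.
- move=> n f; apply: mirror_conj_rots => g; rewrite ampl_pull; last exact: raise_inj.
  exact: raise_mirrored.
- move=> n; have [_ cp] := Mp; apply/esym/cp; apply: commutant_on1; first exact: lower_inj.
  exact: (@stable_on1_cnt n (fun c => c == 0%N) (fun=> 1%N) (@lower_inj n)).
Qed.

End Central.

Lemma abelian_projection_eq0 p : abelian_projection_in M p -> p = fun=> 0.
Proof.
move=> [[Mp pp _] ab]; have [bp _] := Mp; have /bopP[lp [B B0 HB]] := bp.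
apply/funext => h; have pz : p (p h) = p h by exact: (congr1 (fun q => q h) pp).
move: (p h) pz => z pz.
have c0 := isqrt2_gt0 R; pose K := 2 * B + 1 + 1 + isqrt2 R.
have K0 : 0 < K by rewrite !addr_gt0// mulr_gt0.
(* It is enough to bound the norm of z / sqrt 2 by K * e for every e > 0. *)
apply: nrm_le0_eq0; rewrite -(pmulr_rle0 _ c0); apply/ler_addgt0Pl => d d0; rewrite addr0.
have [e e0 ->] : exists2 e, 0 < e & d = K * e.
  by exists (d / K); [rewrite divr_gt0|rewrite mulrC divfK// gt_eqF].
have [N1 H1] := tail_vac_central Mp z e0; have [N2 H2] := tail_raise_central Mp z e0.
have [N3 H3] := vacproj_strong z e0; pose n := maxn N1 (maxn N2 N3).
have a1 := H1 n (leq_maxl _ _).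
have a2 := H2 n (leq_trans (leq_maxl _ _) (leq_maxr _ _)).
have a3 := H3 n (leq_trans (leq_maxr _ _) (leq_maxr _ _)).
rewrite pz in a1; rewrite pz in a2.
have lZ := tail_raise_linear n.
have b4 := abelian_almost_kills lp (tail_vac_linear n) lZ B0 HB (tail_vac_bounded_by n)
  (tail_raise_bounded_by n) pp (ab _ _ (tail_vac_in n) (tail_raise_in n))
  (vac_raise n) (raise_vac n) pz a1 a2.
have b5 := nrmD (tail_raise n z) (tail_raise n (vacproj n z - z)).
rewrite -(linopD _ _ lZ) addrC subrK in b5.
have b6 := tail_raise_bounded_by n (vacproj n z - z); rewrite mul1r nrmBC in b6.
have b7 := tail_raise_lower_bound n z.
have b8 := nrmD (z - vacproj n z) (vacproj n z); rewrite subrK in b8.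
apply: le_trans (ler_wpM2l (ltW c0) b8) _; rewrite mulrDr /K [_ + isqrt2 R]addrC mulrDl.
apply: lerD; first by rewrite ler_pM2l.
apply: le_trans b7 _; apply: le_trans b5 _; rewrite mulrDl mul1r; apply: lerD b4 _.
exact: le_trans b6 a3.
Qed.

End NotTypeI.

Theorem corollary3p20 (R : realType) : ~ type_I_cstar (wam_algebra R).
Proof.
move=> HT; have := HT _ _ (wam_rep_nondegenerate R) id.
case.
- split=> //; split; first exact: bop_id.
  by move=> S _.
- split; last by move=> S _.
  by split; [exact: bop_id|move=> S _].
- have x : wam_word := exist _ [::] isT.
  by move=> /(congr1 (fun q => q (l2_delta R (x, x)))); exact: l2_delta_neq0.
- by move=> p [ap p0 _]; apply: p0; exact: abelian_projection_eq0.
Qed.
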